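(* Suppose Assumptions 2, 3, 4 and 5 (stated in the context) hold and $V_T=o(T)$. Let $\{(\boldsymbol{x}_{i,t},\boldsymbol{y}_{i,t})\}$ be generated by Algorithm Multi-DOSMD-CCO (described in the context) with $$\alpha_t=\frac1{\epsilon_1}t^{-\gamma_1},\qquad \eta_t=\frac1{\epsilon_2}t^{-\gamma_2},\qquad \epsilon_1,\epsilon_2>0,\ \gamma_1,\gamma_2\in(0,1).$$ Then, for $T\ge2$ and $j\in\mathcal V$, $$\textbf{ESP-Regret}_d^j(T)\le\mathcal O\Big(\max\Big\{\Big(1+\frac{\Gamma_1\sigma_1^{\underline K-1}}{1-\sigma_1^{\underline K}}\Big)T^{\theta_1},\ T^{\theta_2}(1+V_T)\Big\}\Big),$$ where $\theta_1=\max\{1-\gamma_1,1-\gamma_2\}$, $\theta_2=\max\{\gamma_1,\gamma_2\}$, $\underline K=\min_{t\in[T]}\{K_t\}$, $\Gamma_1=(1-\zeta/(4n^2))^{-1}$ and $\sigma_1=1-\zeta/(4n^2)$.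
   Context: **Problem.** $[m]=\{1,\dots,m\}$; $\|\cdot\|$ is a norm (on $\mathbb R^d$, resp. $\mathbb R^m$), $\|\cdot\|_*$ its dual norm, and matrix norms are the induced operator norms. $\boldsymbol{X}\subset\mathbb R^d$, $\boldsymbol{Y}\subset\mathbb R^m$ are convex compact sets with diameters (in $\|\cdot\|$) at most $M_X>0$, $M_Y>0$. For agents $i\in\mathcal V=[n]$ and times $t\ge1$, $f_{i,t}:\mathbb R^d\times\mathbb R^m\to\mathbb R$ is convex in the first and concave in the second argument; $f_t=\sum_{i=1}^n f_{i,t}$. For each $t$, $(\boldsymbol{x}_t^*,\boldsymbol{y}_t^* )\in\boldsymbol{X}\times\boldsymbol{Y}$ is a saddle point of $f_t$: $f_t(\boldsymbol{x}_t^*,\boldsymbol{y})\le f_t(\boldsymbol{x}_t^*,\boldsymbol{y}_t^* )\le f_t(\boldsymbol{x},\boldsymbol{y}_t^* )$ for all $\boldsymbol{x}\in\boldsymbol{X},\boldsymbol{y}\in\boldsymbol{Y}$. The expected dynamic saddle point regret of agent $j$ is $$\textbf{ESP-Regret}_d^j(T)=\Big|\mathbb E\Big[\sum_{t=1}^T f_t(\boldsymbol{x}_{j,t},\boldsymbol{y}_{j,t})-\sum_{t=1}^T f_t(\boldsymbol{x}_t^*,\boldsymbol{y}_t^* )\Big]\Big|.$$ The path-variation is $V_T=\max\{V_T^x,V_T^y\}$ with $V_T^x=\sum_{t=1}^T\|\boldsymbol{x}_{t+1}^*-B_t\boldsymbol{x}_t^*\|$, $V_T^y=\sum_{t=1}^T\|\boldsymbol{y}_{t+1}^*-C_t\boldsymbol{y}_t^*\|$.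 **$\mathcal O$ convention.** The constant hidden in $\mathcal O(\cdot)$ does not depend on $T$, $V_T$, or the quantity $\Gamma_1\sigma_1^{\underline K-1}/(1-\sigma_1^{\underline K})$ displayed in the bound (in particular not on the $K_t$); it may depend on the other problem constants ($n$, $L_X,L_Y,\varrho_x,\varrho_y,K_X,K_Y$, $\epsilon_1,\epsilon_2,\gamma_1,\gamma_2$, the maxima of $\Psi_{\mathcal R}^x$ over $\boldsymbol{X}\times\boldsymbol{X}$ and $\Psi_{\mathcal R}^y$ over $\boldsymbol{Y}\times\boldsymbol{Y}$, and the initial decisions). **Network.** $\mathcal G_t=(\mathcal V,\mathcal E_t,A_t)$ is a directed time-varying graph with doubly stochastic weight matrix $A_t\in\mathbb R^{n\times n}$; $\mathcal N_i^{in}(t)=\{i\}\cup\{j:(j,i)\in\mathcal E_t\}$; for a fixed $0<\zeta<1$, $[A_t]_{ij}>\zeta$ if $j\in\mathcal N_i^{in}(t)$ and $[A_t]_{ij}=0$ otherwise. **Bregman divergences.** $\mathcal R^x:\mathbb R^d\to\mathbb R$, $\mathcal R^y:\mathbb R^m\to\mathbb R$ are differentiable and respectively $\varrho_x$- and $\varrho_y$-strongly convex (w.r.t. $\|\cdot\|$) on $\boldsymbol{X}$, $\boldsymbol{Y}$; $\Psi_{\mathcal R}^x(\boldsymbol{x}_a,\boldsymbol{x}_b)=\mathcal R^x(\boldsymbol{x}_a)-\mathcal R^x(\boldsymbol{x}_b)-\langle\nabla\mathcal R^x(\boldsymbol{x}_b),\boldsymbol{x}_a-\boldsymbol{x}_b\rangle$,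 and $\Psi_{\mathcal R}^y$ is defined analogously from $\mathcal R^y$. Thus $\Psi_{\mathcal R}^x(\boldsymbol{x}_a,\boldsymbol{x}_b)\ge\frac{\varrho_x}{2}\|\boldsymbol{x}_a-\boldsymbol{x}_b\|^2$ on $\boldsymbol{X}$, and likewise for $y$ on $\boldsymbol{Y}$. **Algorithm Multi-DOSMD-CCO.** Given initial decisions $\boldsymbol{x}_{i,1}\in\boldsymbol{X},\boldsymbol{y}_{i,1}\in\boldsymbol{Y}$, step sizes $\alpha_t,\eta_t>0$, positive integers $K_t$, and prediction matrices $B_t\in\mathbb R^{d\times d}$, $C_t\in\mathbb R^{m\times m}$. At each $t=1,\dots,T$, each agent $i$: (1) obtains stochastic gradients $\widetilde\nabla_{i,t}^x=\widetilde\nabla_{i,t}^x(\boldsymbol{x}_{i,t},\boldsymbol{y}_{i,t})$, $\widetilde\nabla_{i,t}^y=\widetilde\nabla_{i,t}^y(\boldsymbol{x}_{i,t},\boldsymbol{y}_{i,t})$ (from two independent stochastic oracles) and finds $\boldsymbol{z}_{i,t},\boldsymbol{v}_{i,t}$ with $\nabla\mathcal R^x(\boldsymbol{z}_{i,t})=\nabla\mathcal R^x(\boldsymbol{x}_{i,t})-\alpha_t\widetilde\nabla_{i,t}^x$, $\nabla\mathcal R^y(\boldsymbol{v}_{i,t})=\nabla\mathcal R^y(\boldsymbol{y}_{i,t})+\eta_t\widetilde\nabla_{i,t}^y$; (2) sets $\tilde{\boldsymbol{x}}_{i,t}=\arg\min_{\boldsymbol{x}\in\boldsymbol{X}}\Psi_{\mathcal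 R}^x(\boldsymbol{x},\boldsymbol{z}_{i,t})$, $\tilde{\boldsymbol{y}}_{i,t}=\arg\min_{\boldsymbol{y}\in\boldsymbol{Y}}\Psi_{\mathcal R}^y(\boldsymbol{y},\boldsymbol{v}_{i,t})$; (3) sets $\boldsymbol{s}_{i,t}^{x,1}=B_t\tilde{\boldsymbol{x}}_{i,t}$, $\boldsymbol{s}_{i,t}^{y,1}=C_t\tilde{\boldsymbol{y}}_{i,t}$; (4) for $k=1,\dots,K_t$ sets $\boldsymbol{s}_{i,t}^{x,k+1}=\sum_{j\in\mathcal N_i^{in}(t)}[A_t]_{ij}\boldsymbol{s}_{j,t}^{x,k}$, $\boldsymbol{s}_{i,t}^{y,k+1}=\sum_{j\in\mathcal N_i^{in}(t)}[A_t]_{ij}\boldsymbol{s}_{j,t}^{y,k}$; (5) sets $\boldsymbol{x}_{i,t+1}=\boldsymbol{s}_{i,t}^{x,K_t+1}$, $\boldsymbol{y}_{i,t+1}=\boldsymbol{s}_{i,t}^{y,K_t+1}$. $\mathcal F_t$ is the $\sigma$-field of the entire history of random variables up to time $t$. **Assumption 2.** For all $\boldsymbol{x}\in\boldsymbol{X},\boldsymbol{y}\in\boldsymbol{Y}$: $\mathbb E[\widetilde\nabla_{i,t}^x(\boldsymbol{x},\boldsymbol{y})|\mathcal F_{t-1}]=\nabla_xf_{i,t}(\boldsymbol{x},\boldsymbol{y})$, $\mathbb E[\widetilde\nabla_{i,t}^y(\boldsymbol{x},\boldsymbol{y})|\mathcal F_{t-1}]=\nabla_yf_{i,t}(\boldsymbol{x},\boldsymbol{y})$,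 $\mathbb E[\|\widetilde\nabla_{i,t}^x(\boldsymbol{x},\boldsymbol{y})\|_*^2|\mathcal F_{t-1}]\le L_X^2$, $\mathbb E[\|\widetilde\nabla_{i,t}^y(\boldsymbol{x},\boldsymbol{y})\|_*^2|\mathcal F_{t-1}]\le L_Y^2$. **Assumption 3.** (i) For all $\boldsymbol{x}_a,\boldsymbol{x}_b,\boldsymbol{x}_c\in\boldsymbol{X}$ and $\boldsymbol{y}_a,\boldsymbol{y}_b,\boldsymbol{y}_c\in\boldsymbol{Y}$: $|\Psi_{\mathcal R}^x(\boldsymbol{x}_a,\boldsymbol{x}_c)-\Psi_{\mathcal R}^x(\boldsymbol{x}_b,\boldsymbol{x}_c)|\le K_X\|\boldsymbol{x}_a-\boldsymbol{x}_b\|$, $|\Psi_{\mathcal R}^y(\boldsymbol{y}_a,\boldsymbol{y}_c)-\Psi_{\mathcal R}^y(\boldsymbol{y}_b,\boldsymbol{y}_c)|\le K_Y\|\boldsymbol{y}_a-\boldsymbol{y}_b\|$. (ii) For all $\boldsymbol{x},\boldsymbol{z}_i\in\mathbb R^d$, $\boldsymbol{y},\boldsymbol{v}_i\in\mathbb R^m$ and all $\boldsymbol{s}$ in the probability simplex of $\mathbb R^n$: $\Psi_{\mathcal R}^x(\boldsymbol{x},\sum_i[\boldsymbol{s}]_i\boldsymbol{z}_i)\le\sum_i[\boldsymbol{s}]_i\Psi_{\mathcal R}^x(\boldsymbol{x},\boldsymbol{z}_i)$ and $\Psi_{\mathcal R}^y(\boldsymbol{y},\sum_i[\boldsymbol{s}]_i\boldsymbol{v}_i)\le\sum_i[\boldsymbol{s}]_i\Psi_{\mathcal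 R}^y(\boldsymbol{y},\boldsymbol{v}_i)$. **Assumption 4.** For all $t\in[T]$, $\boldsymbol{x}_a,\boldsymbol{x}_b\in\boldsymbol{X}$, $\boldsymbol{y}_a,\boldsymbol{y}_b\in\boldsymbol{Y}$: $\Psi_{\mathcal R}^x(B_t\boldsymbol{x}_a,B_t\boldsymbol{x}_b)\le\Psi_{\mathcal R}^x(\boldsymbol{x}_a,\boldsymbol{x}_b)$, $\Psi_{\mathcal R}^y(C_t\boldsymbol{y}_a,C_t\boldsymbol{y}_b)\le\Psi_{\mathcal R}^y(\boldsymbol{y}_a,\boldsymbol{y}_b)$; $\|B_t\|\le1$, $\|C_t\|\le1$; and $B_t\boldsymbol{x}\in\boldsymbol{X}$, $C_t\boldsymbol{y}\in\boldsymbol{Y}$ whenever $\boldsymbol{x}\in\boldsymbol{X}$, $\boldsymbol{y}\in\boldsymbol{Y}$. **Assumption 5.** $\mathcal G_t$ is strongly connected for every $t\in[T]$.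
   Formalization: Assumption 2 (unbiasedness and bounded second moment given F_{t-1}) is required not only at every fixed (x,y) in X×Y but also at the random query points (x_{i,t}, y_{i,t}); with fixed points only, the claim is false. *)

(* Defs.v *)
From HB Require Import structures.
From mathcomp Require Import all_boot all_order all_algebra.
From mathcomp Require Import all_classical all_reals all_analysis.

Set Implicit Arguments.
Unset Strict Implicit.
Unset Printing Implicit Defensive.

Import Order.TTheory GRing.Theory Num.Theory.
Import numFieldNormedType.Exports.

Local Open Scope classical_set_scope.
Local Open Scope ring_scope.

Section EuclideanSpace.
Context {R : realType} {d : nat}.
Implicit Types (N Rg F : 'cV[R]_d -> R) (X : set 'cV[R]_d) (u v a b : 'cV[R]_d).

(* An arbitrary norm on R^d: 'cV[R]_d carries the sup norm canonically, which
   is used here only for its (norm-independent) topology and differentials. *)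
Record is_norm N : Prop := IsNorm {
  norm_triangle : forall u v, N (u + v) <= N u + N v;
  norm_scale : forall (c : R) u, N (c *: u) = `|c| * N u;
  norm_separated : forall u, N u = 0 -> u = 0 }.

Definition dotv u v : R := \sum_(k < d) u k 0 * v k 0.

Definition dual_norm N (g : 'cV[R]_d) : R :=
  sup [set dotv g u | u in [set u | N u <= 1]].

Definition op_norm N (B : 'M[R]_d) : R :=
  sup [set N (B *m u) | u in [set u | N u <= 1]].

(* Meaningful only where F is differentiable. *)
Definition grad F u : 'cV[R]_d := \col_k 'D_(delta_mx k 0) (F : _ -> R^o) u.

Definition strongly_convex_on N X (rho : R) Rg : Prop :=
  forall a b (l : R), X a -> X b -> 0 <= l <= 1 ->
    Rg (l *: a + (1 - l) *: b) <=
      l * Rg a + (1 - l) * Rg b - rho / 2 * l * (1 - l) * N (a - b) ^+ 2.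

Definition bregman Rg a b : R := Rg a - Rg b - dotv (grad Rg b) (a - b).

Definition bregman_max Rg X : R := sup [set bregman Rg a b | a in X & b in X].

Definition bregman_projection Rg X (z zt : 'cV[R]_d) : Prop :=
  X zt /\ forall u, X u -> bregman Rg zt z <= bregman Rg u z.

Definition feasible_set N X (M : R) : Prop :=
  [/\ convex_set (X : set (convex_lmodType 'cV[R]_d)), compact X, 0 < M &
      forall a b, X a -> X b -> N (a - b) <= M].

Definition distance_generating N X (rho : R) Rg : Prop :=
  (forall u, differentiable (Rg : _ -> R^o) u) /\ strongly_convex_on N X rho Rg.

Definition bregman_lipschitz N X Rg (K : R) : Prop :=
  forall a b c, X a -> X b -> X c ->
    `|bregman Rg a c - bregman Rg b c| <= K * N (a - b).

(* Convexity of the divergence in its second argument, for n points. *)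
Definition bregman_separately_convex (n : nat) Rg : Prop :=
  forall a (z : 'I_n -> 'cV[R]_d) (s : 'I_n -> R),
    (forall i, 0 <= s i) -> \sum_i s i = 1 ->
    bregman Rg a (\sum_i s i *: z i) <= \sum_i s i * bregman Rg a (z i).

Definition admissible_prediction N X Rg (B : 'M[R]_d) : Prop :=
  [/\ forall a b, X a -> X b -> bregman Rg (B *m a) (B *m b) <= bregman Rg a b,
      op_norm N B <= 1 & forall a, X a -> X (B *m a)].

Definition path_length N (B : nat -> 'M[R]_d) (ustar : nat -> 'cV[R]_d)
    (T : nat) : R :=
  \sum_(1 <= t < T.+1) N (ustar t.+1 - B t *m ustar t).

End EuclideanSpace.

Section Network.
Context {R : realType} {n : nat}.
Implicit Types (E : rel 'I_n) (A : 'M[R]_n).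

(* E j i means that (j, i) is an edge: i receives from j. *)
Definition in_neighbours E (i : 'I_n) : {set 'I_n} := i |: [set j | E j i].

Definition doubly_stochastic A : Prop :=
  [/\ forall i j, 0 <= A i j, forall i, \sum_j A i j = 1 &
      forall j, \sum_i A i j = 1].

Definition weighted_by (zeta : R) E A : Prop :=
  forall i j, (j \in in_neighbours E i -> zeta < A i j) /\
              (j \notin in_neighbours E i -> A i j = 0).

Definition strongly_connected E : Prop := forall i j, connect E i j.

(* k consensus rounds, i.e. s^{k+1} when started from s = s^1. *)
Definition consensus {d : nat} E A (k : nat) (s : 'I_n -> 'cV[R]_d) :
    'I_n -> 'cV[R]_d :=
  iter k (fun s' i => \sum_(j in in_neighbours E i) A i j *: s' j) s.

Definition Gamma1 (zeta : R) : R := (1 - zeta / (4 * n%:R ^+ 2))^-1.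
Definition sigma1 (zeta : R) : R := 1 - zeta / (4 * n%:R ^+ 2).

End Network.
Arguments Gamma1 {R} n zeta.
Arguments sigma1 {R} n zeta.

Section SaddlePointProblem.
Context {R : realType} {n d m : nat}.
Implicit Types (X : set 'cV[R]_d) (Y : set 'cV[R]_m)
  (f : 'I_n -> nat -> 'cV[R]_d -> 'cV[R]_m -> R).

(* The partial gradients are required to exist on X x Y, where they are used. *)
Definition convex_concave_losses X Y f : Prop :=
  forall i t, (0 < t)%N ->
  [/\ forall y, convex_function (setT : set (convex_lmodType 'cV[R]_d))
                  (fun x => f i t x y),
      forall x, convex_function (setT : set (convex_lmodType 'cV[R]_m))
                  (fun y => - f i t x y),
      forall x y, X x -> Y y -> differentiable ((fun u => f i t u y) : _ -> R^o) x
    & forall x y, X x -> Y y -> differentiable ((fun v => f i t x v) : _ -> R^o) y].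

Definition total_loss f (t : nat) (x : 'cV[R]_d) (y : 'cV[R]_m) : R :=
  \sum_(i < n) f i t x y.

Definition saddle_point X Y (F : 'cV[R]_d -> 'cV[R]_m -> R)
    (xs : 'cV[R]_d) (ys : 'cV[R]_m) : Prop :=
  [/\ X xs, Y ys, forall y, Y y -> F xs y <= F xs ys
    & forall x, X x -> F xs ys <= F x ys].

Definition path_variation (Nx : 'cV[R]_d -> R) (Ny : 'cV[R]_m -> R)
    (B : nat -> 'M[R]_d) (C : nat -> 'M[R]_m)
    (xstar : nat -> 'cV[R]_d) (ystar : nat -> 'cV[R]_m) (T : nat) : R :=
  Num.max (path_length Nx B xstar T) (path_length Ny C ystar T).

Definition polynomial_step (eps gam : R) (t : nat) : R :=
  eps^-1 * (t%:R `^ (- gam)).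

End SaddlePointProblem.

Section Probability.
Context {R : realType} {disp : measure_display} {Omega : measurableType disp}.
Variable P : probability Omega R.
Implicit Types (G : set_system Omega).

Definition vec_events {k : nat} (xi : Omega -> 'cV[R]_k) : set_system Omega :=
  [set D | exists (l : 'I_k) (U : set R),
     measurable U /\ D = (fun w => xi w l 0) @^-1` U].

Definition random_vector {k : nat} (xi : Omega -> 'cV[R]_k) : Prop :=
  forall l : 'I_k, measurable_fun setT (fun w => xi w l 0).

(* h is a version of the conditional expectation of Z given the sigma-field G. *)
Definition is_cond_exp G (Z h : Omega -> R) : Prop :=
  [/\ P.-integrable setT (EFin \o Z), P.-integrable setT (EFin \o h),
      forall U : set R, measurable U -> G (h @^-1` U)
    & forall D, G D ->
        (\int[P]_(w in D) (Z w)%:E = \int[P]_(w in D) (h w)%:E)%E].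

Definition is_cond_exp_vec {k : nat} G (g h : Omega -> 'cV[R]_k) : Prop :=
  forall l : 'I_k, is_cond_exp G (fun w => g w l 0) (fun w => h w l 0).

Definition cond_exp_le G (Z : Omega -> R) (c : R) : Prop :=
  exists2 h : Omega -> R, is_cond_exp G Z h & {ae P, forall w, h w <= c}.

Definition unbiased_bounded {k : nat} G (N : 'cV[R]_k -> R) (L : R)
    (g mean : Omega -> 'cV[R]_k) : Prop :=
  is_cond_exp_vec G g mean /\
  cond_exp_le G (fun w => dual_norm N (g w) ^+ 2) (L ^+ 2).

Definition independent_systems (G1 G2 : set_system Omega) : Prop :=
  forall D1 D2, G1 D1 -> G2 D2 -> (P (D1 `&` D2) = P D1 * P D2)%E.

End Probability.

(* The oracles are random fields over the decision pairs; the other components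
   are the sequences x, z, x~ and y, v, y~ of the algorithm. *)
Record run (R : realType) (Omega : Type) (n d m : nat) := Run {
  oracle_x : 'I_n -> nat -> Omega -> 'cV[R]_d -> 'cV[R]_m -> 'cV[R]_d;
  oracle_y : 'I_n -> nat -> Omega -> 'cV[R]_d -> 'cV[R]_m -> 'cV[R]_m;
  dec_x : 'I_n -> nat -> Omega -> 'cV[R]_d;
  dec_y : 'I_n -> nat -> Omega -> 'cV[R]_m;
  dual_x : 'I_n -> nat -> Omega -> 'cV[R]_d;
  dual_y : 'I_n -> nat -> Omega -> 'cV[R]_m;
  proj_x : 'I_n -> nat -> Omega -> 'cV[R]_d;
  proj_y : 'I_n -> nat -> Omega -> 'cV[R]_m }.

Section Algorithm.
Context {R : realType} {disp : measure_display} {Omega : measurableType disp}.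
Context {n d m : nat}.
Variable P : probability Omega R.
Variable r : run R Omega n d m.
Implicit Types (X : set 'cV[R]_d) (Y : set 'cV[R]_m) (T : nat).

Definition sgrad_x i t (w : Omega) : 'cV[R]_d :=
  oracle_x r i t w (dec_x r i t w) (dec_y r i t w).
Definition sgrad_y i t (w : Omega) : 'cV[R]_m :=
  oracle_y r i t w (dec_x r i t w) (dec_y r i t w).

(* F_t. Round t ends with the computation of the decisions of index t+1, which
   therefore belong to the history up to time t. *)
Definition history (t : nat) : set_system Omega :=
  <<s [set D | exists (i : 'I_n) (s : nat), (1 <= s <= t.+1)%N /\
        (vec_events (dec_x r i s) D \/ vec_events (dec_y r i s) D)] `|`
      [set D | exists (i : 'I_n) (s : nat), (1 <= s <= t)%N /\
        [\/ vec_events (sgrad_x i s) D \/ vec_events (sgrad_y i s) D,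
            vec_events (dual_x r i s) D \/ vec_events (dual_y r i s) D
          | vec_events (proj_x r i s) D \/ vec_events (proj_y r i s) D]] >>.

Definition oracle_sigma {k : nat} X Y
    (g : Omega -> 'cV[R]_d -> 'cV[R]_m -> 'cV[R]_k) : set_system Omega :=
  <<s [set D | exists x y, [/\ X x, Y y & vec_events (fun w => g w x y) D]] >>.

Record multi_dosmd_cco X Y (Rx : 'cV[R]_d -> R) (Ry : 'cV[R]_m -> R)
    (alpha eta : nat -> R) (K : nat -> nat)
    (E : nat -> rel 'I_n) (A : nat -> 'M[R]_n)
    (B : nat -> 'M[R]_d) (C : nat -> 'M[R]_m)
    (x1 : 'I_n -> 'cV[R]_d) (y1 : 'I_n -> 'cV[R]_m) T : Prop := MultiDosmdCco {
  run_init : forall i w, dec_x r i 1 w = x1 i /\ dec_y r i 1 w = y1 i;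
  run_random : forall i t, (1 <= t <= T)%N ->
    [/\ random_vector (sgrad_x i t) /\ random_vector (sgrad_y i t),
        random_vector (dual_x r i t) /\ random_vector (dual_y r i t),
        random_vector (proj_x r i t) /\ random_vector (proj_y r i t)
      & random_vector (dec_x r i t.+1) /\ random_vector (dec_y r i t.+1)];
  run_oracles : forall i t, (1 <= t <= T)%N ->
    independent_systems P (oracle_sigma X Y (oracle_x r i t))
                          (oracle_sigma X Y (oracle_y r i t));
  run_mirror : forall i t w, (1 <= t <= T)%N ->
    grad Rx (dual_x r i t w) = grad Rx (dec_x r i t w) - alpha t *: sgrad_x i t w /\
    grad Ry (dual_y r i t w) = grad Ry (dec_y r i t w) + eta t *: sgrad_y i t w;
  run_project : forall i t w, (1 <= t <= T)%N ->
    bregman_projection Rx X (dual_x r i t w) (proj_x r i t w) /\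
    bregman_projection Ry Y (dual_y r i t w) (proj_y r i t w);
  run_consensus : forall i t w, (1 <= t <= T)%N ->
    dec_x r i t.+1 w =
      consensus (E t) (A t) (K t) (fun j => B t *m proj_x r j t w) i /\
    dec_y r i t.+1 w =
      consensus (E t) (A t) (K t) (fun j => C t *m proj_y r j t w) i }.

Definition oracle_at (Nx : 'cV[R]_d -> R) (Ny : 'cV[R]_m -> R) (LX LY : R)
    (f : 'I_n -> nat -> 'cV[R]_d -> 'cV[R]_m -> R) (i : 'I_n) (t : nat)
    (u : Omega -> 'cV[R]_d) (v : Omega -> 'cV[R]_m) : Prop :=
  unbiased_bounded P (history t.-1) Nx LX
    (fun w => oracle_x r i t w (u w) (v w))
    (fun w => grad (fun x => f i t x (v w)) (u w)) /\
  unbiased_bounded P (history t.-1) Ny LY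
    (fun w => oracle_y r i t w (u w) (v w))
    (fun w => grad (fun y => f i t (u w) y) (v w)).

(* The condition at the random point (x_{i,t}, y_{i,t}) is not a formal
   consequence of the one at all deterministic points: an arbitrary random field
   may be altered at an F_{t-1}-measurable, continuously distributed point
   without changing its law at any fixed point. Both are part of the assumption
   that the oracle is unbiased with bounded second moment where it is queried. *)
Definition stochastic_oracles Nx Ny LX LY X Y f T : Prop :=
  forall i t, (1 <= t <= T)%N ->
  (forall x y, X x -> Y y -> oracle_at Nx Ny LX LY f i t (cst x) (cst y)) /\
  oracle_at Nx Ny LX LY f i t (dec_x r i t) (dec_y r i t).

Definition ESP_regret (f : 'I_n -> nat -> 'cV[R]_d -> 'cV[R]_m -> R)
    (xstar : nat -> 'cV[R]_d) (ystar : nat -> 'cV[R]_m) (j : 'I_n) T : \bar R :=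
  (`| 'E_P[(fun w =>
        \sum_(1 <= t < T.+1) total_loss f t (dec_x r j t w) (dec_y r j t w) -
        \sum_(1 <= t < T.+1) total_loss f t (xstar t) (ystar t))%R] |)%E.

End Algorithm.

(* K_ = min_{t in [T]} K_t, for T >= 1. *)
Definition min_rounds (K : nat -> nat) (T : nat) : nat :=
  \big[minn/K 1]_(1 <= t < T.+1) K t.

(* Main.v *)
(* Mirror descent: the three-point identity for a Bregman projection bounds
   sum_t <g_t, x_t - x*_t> by a telescoping sum of divergences plus the gradient
   energy; separate convexity of the divergence makes consensus harmless and its
   Lipschitz continuity charges the drift x*_{t+1} - B_t x*_t to the path length.
   Convexity-concavity turns the regret of agent j into these inner products up to
   the disagreement x_{i,t} - x_{j,t}, because the losses are Lipschitz: their
   gradients are means of stochastic gradients with bounded second moment.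
   Disagreement is controlled by tensors p_k (x) u_k in R^n (x) R^d: every
   consensus round contracts the dispersion of the p_k by sigma_1 and B_t does not
   increase the norm of the u_k, so the disagreement obeys
   a_{t+1} <= sigma_1^K (a_t + n sum_i |x~_{i,t} - x_{i,t}|).
   The gradient noise has mean zero when tested against the bounded
   F_{t-1}-measurable decisions. The lower bound on the regret is the same
   argument with the two players exchanged and the losses negated. *)

Require Import Defs.
From mathcomp Require Import all_boot all_order all_algebra.
From mathcomp Require Import all_classical all_reals all_analysis.
From mathcomp Require Import measurable_realfun ring lra.

Set Implicit Arguments.
Unset Strict Implicit.
Unset Printing Implicit Defensive.

Import Order.TTheory GRing.Theory Num.Theory.
Import numFieldNormedType.Exports.

Local Open Scope classical_set_scope.
Local Open Scope ring_scope.

(** * Norms, gradients and Bregman divergences *)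

(** An arbitrary norm on R^d satisfies no variance identity, so the [sigma1] contraction, an l2 fact
    on R^n, is proved for scalars and carried over by the tensors. First moments of dual norms are
    reduced to second moments by s <= 1 + s^2, which is where the factors 1 + L^2 come from. The
    final constant is fixed before the sets and norms are chosen, so diameters are recovered from
    the divergence maximum and strong convexity rather than from M. Measurability of the regret is
    bypassed: the regret and its opposite are bounded pointwise by integrable functions, and only
    those are averaged. Consensus enters the final bound through 1 / (1 - q) with q = sigma_1^K,
    which the displayed factor dominates because [Gamma1] is the inverse of [sigma1]. *)

Section DotProduct.
Context {R : realType} {d : nat}.
Implicit Types u v g : 'cV[R]_d.

Lemma dotvDl g h u : dotv (g + h) u = dotv g u + dotv h u.
Proof. by rewrite /dotv -big_split; apply: eq_bigr => k _; rewrite mxE mulrDl. Qed.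

Lemma dotvDr g u v : dotv g (u + v) = dotv g u + dotv g v.
Proof. by rewrite /dotv -big_split; apply: eq_bigr => k _; rewrite mxE mulrDr. Qed.

Lemma dotvZl c g u : dotv (c *: g) u = c * dotv g u.
Proof. by rewrite /dotv mulr_sumr; apply: eq_bigr => k _; rewrite mxE mulrA. Qed.

Lemma dotvZr c g u : dotv g (c *: u) = c * dotv g u.
Proof. by rewrite /dotv mulr_sumr; apply: eq_bigr => k _; rewrite mxE mulrCA. Qed.

Lemma dotvNl g u : dotv (- g) u = - dotv g u.
Proof. by rewrite -scaleN1r dotvZl mulN1r. Qed.

Lemma dotvNr g u : dotv g (- u) = - dotv g u.
Proof. by rewrite -scaleN1r dotvZr mulN1r. Qed.

Lemma dotvBl g h u : dotv (g - h) u = dotv g u - dotv h u.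
Proof. by rewrite dotvDl dotvNl. Qed.

Lemma dotvBr g u v : dotv g (u - v) = dotv g u - dotv g v.
Proof. by rewrite dotvDr dotvNr. Qed.

Lemma dotv0r g : dotv g 0 = 0.
Proof. by rewrite /dotv big1// => k _; rewrite mxE mulr0. Qed.

Lemma colv_sum_delta u : u = \sum_k u k 0 *: delta_mx k 0.
Proof.
apply/matrixP => i j; rewrite summxE (bigD1 i)//= big1 => [|k ki].
  by rewrite !mxE !ord1 !eqxx mulr1 addr0.
by rewrite !mxE eq_sym (negbTE ki) mulr0.
Qed.

End DotProduct.

Section NormTheory.
Context {R : realType} {d : nat} {N : 'cV[R]_d -> R}.
Hypothesis hN : is_norm N.
Implicit Types u v g : 'cV[R]_d.

Lemma norm0v : N 0 = 0.
Proof. by rewrite -(scale0r 0) (norm_scale hN) normr0 mul0r. Qed.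

Lemma normvN u : N (- u) = N u.
Proof. by rewrite -scaleN1r (norm_scale hN) normrN1 mul1r. Qed.

Lemma normv_ge0 u : 0 <= N u.
Proof.
have := norm_triangle hN u (- u); rewrite subrr norm0v normvN => h; lra.
Qed.

Lemma normv_distC u v : N (u - v) = N (v - u).
Proof. by rewrite -normvN opprB. Qed.

Lemma normv_sum (I : Type) (s : seq I) (F : I -> 'cV[R]_d) :
  N (\sum_(i <- s) F i) <= \sum_(i <- s) N (F i).
Proof.
elim/big_ind2 : _ => [|u a v b ua vb|//]; first by rewrite norm0v.
by rewrite (le_trans (norm_triangle hN _ _))// lerD.
Qed.

Lemma normv_triangle3 u v w : N (u - w) <= N (u - v) + N (v - w).
Proof. by rewrite (le_trans _ (norm_triangle hN _ _))// subrKA. Qed.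

Lemma normv_lipschitz u v : `|N u - N v| <= N (u - v).
Proof.
rewrite ler_norml; have := normv_triangle3 u v 0; have := normv_triangle3 v u 0.
rewrite !subr0 (normv_distC v u) => h1 h2; apply/andP; split; lra.
Qed.

Lemma normv_le_coord (c : R) u : (forall k, `|u k 0| <= c) ->
  N u <= (\sum_k N (delta_mx k 0)) * c.
Proof.
move=> uc; rewrite {1}(colv_sum_delta u) mulr_suml.
apply: (le_trans (normv_sum _ _)); apply: ler_sum => k _.
by rewrite (norm_scale hN) mulrC ler_wpM2l// normv_ge0.
Qed.

(** Transposed to row vectors, the setting of the compactness criterion [bounded_closed_compact]
    applied next. *)
Lemma normv_tr_continuous : continuous (fun u : 'rV[R]_d => N u^T).
Proof.
move=> u; apply/(@cvgrPdist_lt _ _ _ (nbhs u) (nbhs_filter u)) => e e0.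
set C := \sum_k N (delta_mx k 0).
have C0 : 0 <= C by apply: sumr_ge0 => k _; exact: normv_ge0.
have C1 : 0 < C + 1 by lra.
apply/nbhs_ballP; exists (e / (C + 1)); first exact: divr_gt0.
move=> v; rewrite -ball_normE => /= uv.
rewrite (le_lt_trans (normv_lipschitz _ _))//.
rewrite -raddfB/=.
apply: (@le_lt_trans _ _ (C * `|u - v|)).
  apply: normv_le_coord => k; rewrite mxE.
  have -> : `|u - v| = \big[Num.max/0]_ij `|(u - v) ij.1 ij.2| by rewrite -mx_normrE.
  apply: (le_bigmax _ (fun ij : 'I_1 * 'I_d => `|(u - v) ij.1 ij.2|) (0, k)).
move: uv; rewrite ltr_pdivlMr// mulrC mulrDl mul1r => uv.
by apply: le_lt_trans uv; rewrite lerDl.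
Qed.

(** Equivalence of norms: by compactness N attains a minimum on the sup-norm unit sphere, positive
    because N separates points, and C is its inverse. *)
Lemma coord_le_normv : exists2 C, 0 <= C & forall u k, `|u k 0| <= C * N u.
Proof.
pose S := [set v : 'rV[R]_d | `|v| = 1].
have mxle (v : 'rV[R]_d) k : `|v 0 k| <= `|v|.
  have -> : `|v| = \big[Num.max/0]_ij `|v ij.1 ij.2| by rewrite -mx_normrE.
  apply: (le_bigmax _ (fun ij : 'I_1 * 'I_d => `|v ij.1 ij.2|) (0, k)).
have cS : compact S.
  apply: bounded_closed_compact.
    by exists 1; split => // M M1 v /= ->; exact: ltW.
  have -> : S = (fun v : 'rV[R]_d => `|v|) @^-1` [set 1] by [].
  apply: closed_comp => [v _|]; [exact: norm_continuous|exact: closed_eq].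
have [S0|/set0P[v0 Sv0]] := eqVneq S set0; last first.
  have [v Sv vmin] : exists2 v, v \in S & forall t, t \in S -> N v^T <= N t^T.
    apply: (@compact_EVT_min _ _ (fun v : 'rV[R]_d => N v^T)) => //.
      by exists v0.
    apply: continuous_subspaceT; exact: normv_tr_continuous.
  have Nv : 0 < N v^T.
    rewrite lt_def normv_ge0 andbT; apply/eqP => /(norm_separated hN) v0'.
    move: Sv; rewrite inE /S/= -(trmxK v) v0' trmx0 normr0 => /eqP.
    by rewrite eq_sym oner_eq0.
  exists (N v^T)^-1; first by rewrite invr_ge0 ltW.
  move=> u k; rewrite ler_pdivlMl//.
  have [->|u0] := eqVneq u 0; first by rewrite mxE normr0 mulr0 normv_ge0.
  have nu : 0 < `|u^T| by rewrite normr_gt0 -(trmx0) (inj_eq (can_inj trmxK)).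
  have : N v^T <= N (`|u^T|^-1 *: u^T)^T.
    apply: vmin; rewrite inE /S/= normrZ gtr0_norm ?invr_gt0//.
    by rewrite mulVf// gt_eqF.
  rewrite linearZ/= trmxK (norm_scale hN) gtr0_norm ?invr_gt0// ler_pdivlMl// => h.
  apply: le_trans h; rewrite mulrC ler_wpM2r// ?(ltW Nv)//.
  by have := mxle u^T k; rewrite mxE.
(* An empty sphere means that every vector is 0, since a nonzero one could be normalised. *)
exists 0 => // u k.
suff -> : u = 0 by rewrite mxE normr0 mul0r.
apply: (can_inj (@trmxK _ _ _)); rewrite trmx0; apply/eqP/negPn/negP => u0.
suff : S (`|u^T|^-1 *: u^T) by rewrite S0.
by rewrite /S/= normrZ gtr0_norm ?invr_gt0 ?normr_gt0// mulVf// normr_eq0.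
Qed.

(** Bounds the set whose [sup] is [dual_norm], so that this [sup] is a genuine upper bound and not
    the default value. *)
Lemma dotv_norm_bound g : exists2 C, 0 <= C & forall u, `|dotv g u| <= C * N u.
Proof.
have [C C0 CN] := coord_le_normv.
exists (\sum_k `|g k 0| * C) => [|u].
  by apply: sumr_ge0 => k _; rewrite mulr_ge0.
rewrite mulr_suml (le_trans (ler_norm_sum _ _ _))//; apply: ler_sum => k _.
by rewrite normrM -mulrA ler_wpM2l.
Qed.

Lemma dotv_le_dual g u : dotv g u <= dual_norm N g * N u.
Proof.
have [C C0 CN] := dotv_norm_bound g.
have ub : has_sup [set dotv g u | u in [set u | N u <= 1]].
  split; first by exists (dotv g 0), 0 => //=; rewrite norm0v.
  exists C => _ [v /= v1 <-].
  by rewrite (le_trans (ler_norm _))// (le_trans (CN _))// ler_piMr.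
have [->|u0] := eqVneq u 0; first by rewrite dotv0r norm0v mulr0.
have Nu : 0 < N u.
  by rewrite lt_def normv_ge0 andbT; apply: contra u0 => /eqP/(norm_separated hN)->.
rewrite -ler_pdivrMr// mulrC -dotvZr; apply: sup_upper_bound => //.
exists ((N u)^-1 *: u) => //=.
by rewrite (norm_scale hN) gtr0_norm ?invr_gt0// mulVf// gt_eqF.
Qed.

Lemma dual_norm_ge0 g : 0 <= dual_norm N g.
Proof.
have [C C0 CN] := dotv_norm_bound g.
apply: sup_upper_bound; last by exists 0; rewrite /= ?norm0v ?dotv0r.
split; first by exists (dotv g 0), 0 => //=; rewrite norm0v.
exists C => _ [v /= v1 <-].
by rewrite (le_trans (ler_norm _))// (le_trans (CN _))// ler_piMr.
Qed.

Lemma dual_normN g : dual_norm N (- g) = dual_norm N g.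
Proof.
congr sup; apply/seteqP; split=> _ [u /= u1 <-]; exists (- u);
  by rewrite /= ?normvN// dotvNr ?dotvNl ?opprK.
Qed.

Lemma op_norm_le1 (B : 'M[R]_d) : op_norm N B <= 1 ->
  forall u, N (B *m u) <= N u.
Proof.
move=> B1 u; have [C C0 CN] := coord_le_normv.
(* The set has to be bounded before [B1] says anything: [sup] of an unbounded set is 0 by
   default. *)
have ub : has_sup [set N (B *m u) | u in [set u | N u <= 1]].
  split; first by exists (N (B *m 0)), 0 => //=; rewrite norm0v.
  exists ((\sum_k N (delta_mx k 0)) * (\sum_k \sum_l `|B k l| * C)) => _ [v /= v1 <-].
  apply: normv_le_coord => k; rewrite mxE (le_trans (ler_norm_sum _ _ _))//.
  apply: (@le_trans _ _ (\sum_l `|B k l| * C)).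
    apply: ler_sum => l _; rewrite normrM ler_wpM2l//.
    by rewrite (le_trans (CN _ _))// ler_piMr.
  rewrite [leRHS](bigD1 k)//= lerDl; apply: sumr_ge0 => i _; apply: sumr_ge0 => l _.
  by rewrite mulr_ge0.
have [->|u0] := eqVneq u 0; first by rewrite mulmx0 norm0v.
have Nu : 0 < N u.
  by rewrite lt_def normv_ge0 andbT; apply: contra u0 => /eqP/(norm_separated hN)->.
have := @sup_upper_bound _ _ ub (N (B *m ((N u)^-1 *: u))).
rewrite -scalemxAr (norm_scale hN) gtr0_norm ?invr_gt0// => h.
rewrite -(mul1r (N u)) -ler_pdivrMr// mulrC.
apply: le_trans B1; apply: h; exists ((N u)^-1 *: u) => /=.
  by rewrite (norm_scale hN) gtr0_norm ?invr_gt0// mulVf// gt_eqF.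
by rewrite -scalemxAr (norm_scale hN) gtr0_norm ?invr_gt0.
Qed.

End NormTheory.

Section Gradient.
Context {R : realType} {d : nat}.
Implicit Types (u v a : 'cV[R]_d) (F : 'cV[R]_d -> R).

Lemma derive_grad F a v : differentiable (F : _ -> R^o) a ->
  'D_v (F : _ -> R^o) a = dotv (grad F a) v.
Proof.
move=> dF; rewrite deriveE// [in LHS](colv_sum_delta v) linear_sum.
apply: eq_bigr => k _; rewrite linearZ/= mxE deriveE// mulrC.
by [].
Qed.

(** Difference quotients along v are at most c + l * e; let l tend to 0 from the right. The slack e
    makes room for the quadratic term of strong convexity. *)
Lemma grad_dotv_le F a v (c e : R) : differentiable (F : _ -> R^o) a ->
  (forall l, 0 < l < 1 -> F (a + l *: v) - F a <= l * (c + l * e)) ->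
  dotv (grad F a) v <= c.
Proof.
move=> dF FP; rewrite -derive_grad//.
have cvD := diff_derivable (v := v) dF.
have cv1 : h^-1 *: ((F \o shift a) (h *: v) - F a : R^o) @[h --> 0^'+] -->
    'D_v (F : _ -> R^o) a by exact: cvg_dnbhs_at_right.
have cv2 : (h * e : R^o) @[h --> (0 : R)^'+] --> (0 * e : R^o).
  apply: (@cvg_at_right_filter _ _ (fun h : R => h * e : R^o)).
  by apply: cvgM; [exact: cvg_id|exact: cvg_cst].
have := cvgB cv1 cv2; rewrite mul0r subr0 => /(_ _) cv3.
apply: (@cvgr_to_le _ _ _ _ _ _ _ cv3).
near=> h; have h0 : 0 < h by [].
have h1 : h < 1 by [].
rewrite lerBlDr [_ *: _]mulrC ler_pdivrMr// mulrC/= [h *: v + a]addrC; apply: FP.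
by rewrite h0 h1.
Unshelve. all: by end_near. Qed.

Lemma grad_dotv_ge F a v (c e : R) : differentiable (F : _ -> R^o) a ->
  (forall l, 0 < l < 1 -> l * (c - l * e) <= F (a + l *: v) - F a) ->
  c <= dotv (grad F a) v.
Proof.
move=> dF FP; rewrite -lerN2 -derive_grad//.
have dNF : differentiable ((fun x => - F x) : _ -> R^o) a.
  by apply: (@differentiableN _ _ _ (F : _ -> R^o)).
have -> : - 'D_v (F : _ -> R^o) a = 'D_v ((fun x => - F x) : _ -> R^o) a.
  by rewrite -deriveN//; exact: diff_derivable.
rewrite derive_grad//; apply: (@grad_dotv_le _ _ _ _ e) => // l l01.
have := FP l l01; rewrite mulrBr mulrDr; lra.
Qed.

Lemma convex_function_le (f : 'cV[R]_d -> R) u v l :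
  convex_function (setT : set (convex_lmodType 'cV[R]_d)) f ->
  0 <= l <= 1 -> f (l *: u + (1 - l) *: v) <= l * f u + (1 - l) * f v.
Proof.
move=> cf /andP[l0 l1]; have := cf (Itv01 l0 l1) u v.
by rewrite !inE => /(_ I I).
Qed.

Lemma convex_set_conv (X : set 'cV[R]_d) u v l :
  convex_set (X : set (convex_lmodType 'cV[R]_d)) ->
  X u -> X v -> 0 <= l <= 1 -> X (l *: u + (1 - l) *: v).
Proof.
move=> cX Xu Xv /andP[l0 l1].
by have := cX u v (Itv01 l0 l1); rewrite !inE; exact.
Qed.

Lemma segmentE u v (l : R) : u + l *: (v - u) = l *: v + (1 - l) *: u.
Proof. by rewrite scalerBr scalerBl scale1r addrCA addrA. Qed.

Lemma convex_above_tangent F u v :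
  convex_function (setT : set (convex_lmodType 'cV[R]_d)) F ->
  differentiable (F : _ -> R^o) u ->
  F u - F v <= dotv (grad F u) (u - v).
Proof.
move=> cF dF; rewrite -opprB -[u - v]opprB dotvNr lerN2.
apply: (@grad_dotv_le _ _ _ _ 0) => // l /andP[l0 l1].
have l01 : 0 <= l <= 1 by lra.
rewrite segmentE.
have := convex_function_le v u cF l01.
rewrite mulr0 addr0; lra.
Qed.

Lemma convex_set_sum (X : set 'cV[R]_d) (I : finType) (s : I -> R) (z : I -> 'cV[R]_d) :
  convex_set (X : set (convex_lmodType 'cV[R]_d)) ->
  (forall i, 0 <= s i) -> \sum_i s i = 1 -> (forall i, X (z i)) ->
  X (\sum_i s i *: z i).
Proof.
move=> cX s0 s1 Xz.
(* Generalised to partial sums, each equal to its total weight times some point of X; a zero weight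
   leaves that point arbitrary. *)
suff H (r : seq I) : exists2 x, X x &
    \sum_(i <- r) s i *: z i = (\sum_(i <- r) s i) *: x.
  by have [x Xx ->] := H (index_enum I); rewrite s1 scale1r.
elim: r => [|i r [x Xx IH]].
  case: (pickP (pred_of_simpl (@predT I))) => [i _|I0].
    by exists (z i) => //; rewrite !big_nil scale0r.
  by move: s1; rewrite big_pred0// => /eqP; rewrite eq_sym oner_eq0.
rewrite !big_cons IH; set S := \sum_(_ <- r) _.
have S0 : 0 <= S by exact: sumr_ge0.
have [sS|sS] := leP (s i + S) 0.
  have si0 := s0 i; exists x => //; have -> : s i = 0 by lra.
  by rewrite scale0r !add0r.
exists ((s i / (s i + S)) *: z i + (1 - s i / (s i + S)) *: x).
  apply: convex_set_conv => //; rewrite divr_ge0 ?(ltW sS)//=.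
  by rewrite ler_pdivrMr// mul1r lerDl.
rewrite scalerDr !scalerA mulrBr mulr1 mulrCA divff ?gt_eqF// mulr1.
by rewrite [s i + S]addrC addrK.
Qed.

End Gradient.

Section Bregman.
Context {R : realType} {d : nat} {N : 'cV[R]_d -> R}.
Hypothesis hN : is_norm N.
Context {X : set 'cV[R]_d} {rho : R} {Rg : 'cV[R]_d -> R}.
Hypothesis cX : convex_set (X : set (convex_lmodType 'cV[R]_d)).
Hypothesis rho0 : 0 < rho.
Hypothesis dR : forall u, differentiable (Rg : _ -> R^o) u.
Hypothesis sR : strongly_convex_on N X rho Rg.
Implicit Types (u a b x z g : 'cV[R]_d).

Lemma bregmanxx a : bregman Rg a a = 0.
Proof. by rewrite /bregman !subrr dotv0r subrr. Qed.

Lemma bregman_three_points u a b :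
  dotv (grad Rg b - grad Rg a) (u - b) =
  bregman Rg u a - bregman Rg u b - bregman Rg b a.
Proof.
rewrite /bregman; have -> : u - a = (u - b) + (b - a) by rewrite subrKA.
rewrite dotvBl (dotvDr _ (u - b)); ring.
Qed.

(** Strong convexity on the segment from b to a, divided by l; its factor 1 - l costs the slack l *
    e, which vanishes in the limit. *)
Lemma bregman_strong a b : X a -> X b -> rho / 2 * N (a - b) ^+ 2 <= bregman Rg a b.
Proof.
move=> Xa Xb; rewrite /bregman lerBrDl -lerBrDr.
apply: (@grad_dotv_le _ _ _ _ _ _ (rho / 2 * N (a - b) ^+ 2)) => // l /andP[l0 l1].
rewrite segmentE; have l01 : 0 <= l <= 1 by lra.
have := sR Xa Xb l01; lra.
Qed.

Lemma bregman_ge0 a b : X a -> X b -> 0 <= bregman Rg a b.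
Proof.
move=> Xa Xb; apply: le_trans (bregman_strong Xa Xb).
by rewrite mulr_ge0 ?sqr_ge0// divr_ge0// ltW.
Qed.

(** First-order optimality: moving from zt towards u inside X cannot decrease the divergence to
    z. *)
Lemma bregman_projection_opt z zt u : bregman_projection Rg X z zt -> X u ->
  0 <= dotv (grad Rg zt - grad Rg z) (u - zt).
Proof.
move=> [Xzt zt_min] Xu; rewrite dotvBl subr_ge0.
apply: (@grad_dotv_ge _ _ _ _ _ _ 0) => // l /andP[l0 l1].
have l01 : 0 <= l <= 1 by lra.
have := zt_min (l *: u + (1 - l) *: zt) (convex_set_conv cX Xu Xzt l01).
rewrite -segmentE /bregman !dotvBr dotvDr dotvZr dotvBr mulr0; lra.
Qed.

Lemma mirror_step (a : R) g x z zt u :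
  grad Rg z = grad Rg x - a *: g -> bregman_projection Rg X z zt -> X u ->
  a * dotv g (zt - u) <= bregman Rg u x - bregman Rg u zt - bregman Rg zt x.
Proof.
move=> gz pz Xu; have := bregman_projection_opt pz Xu.
rewrite gz opprB addrCA addrC dotvDl bregman_three_points dotvZl.
by rewrite -(opprB zt u) dotvNr; lra.
Qed.

(** With u = x, [mirror_step] leaves the symmetrised divergence, at least rho * N (zt - x)^2,
    against a dual pairing linear in N (zt - x); one factor cancels. *)
Lemma mirror_step_move (a : R) g x z zt : 0 <= a ->
  grad Rg z = grad Rg x - a *: g -> bregman_projection Rg X z zt -> X x ->
  N (zt - x) <= a * dual_norm N g / rho.
Proof.
move=> a0 gz pz Xx; have := mirror_step gz pz Xx.
rewrite bregmanxx sub0r => h.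
have Xzt : X zt by case: pz.
have h1 := bregman_strong Xx Xzt; have h2 := bregman_strong Xzt Xx.
rewrite (normv_distC hN) in h1.
have h3 : a * dotv g (x - zt) <= a * (dual_norm N g * N (zt - x)).
  by rewrite ler_wpM2l// (normv_distC hN) dotv_le_dual.
rewrite -opprB dotvNr in h3.
have := normv_ge0 hN (zt - x); set n := N (zt - x) in h1 h2 h3 *.
rewrite le_eqVlt => /predU1P[<-|n0].
  apply: mulr_ge0; last by rewrite invr_ge0 ltW.
  by apply: mulr_ge0 => //; exact: dual_norm_ge0.
rewrite ler_pdivlMr// -(ler_pM2r n0).
apply: (@le_trans _ _ (rho / 2 * n ^+ 2 + rho / 2 * n ^+ 2)); first by rewrite expr2; nra.
lra.
Qed.

Lemma mirror_step_regret (a : R) g x z zt u : 0 < a ->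
  grad Rg z = grad Rg x - a *: g -> bregman_projection Rg X z zt -> X x -> X u ->
  a * dotv g (x - u) <=
    bregman Rg u x - bregman Rg u zt + a ^+ 2 * dual_norm N g ^+ 2 / (2 * rho).
Proof.
move=> a0 gz pz Xx Xu; have h := mirror_step gz pz Xu.
have Xzt : X zt by case: pz.
have h1 := bregman_strong Xzt Xx.
have h3 : a * dotv g (x - zt) <= a * (dual_norm N g * N (zt - x)).
  by rewrite ler_wpM2l ?(ltW a0)// (normv_distC hN) dotv_le_dual.
have -> : x - u = (x - zt) + (zt - u) by rewrite subrKA.
rewrite dotvDr mulrDr.
suff h4 : a * (dual_norm N g * N (zt - x)) <=
    rho / 2 * N (zt - x) ^+ 2 + a ^+ 2 * dual_norm N g ^+ 2 / (2 * rho).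
  lra.
set n := N _; set e := dual_norm _ _.
(* Young's inequality: the difference of the two sides is a perfect square over 2 * rho. *)
rewrite -subr_ge0.
have -> : rho / 2 * n ^+ 2 + a ^+ 2 * e ^+ 2 / (2 * rho) - a * (e * n) =
  (rho * n - a * e) ^+ 2 / (2 * rho) by field; rewrite gt_eqF.
by rewrite divr_ge0 ?sqr_ge0// mulr_ge0// ltW.
Qed.

End Bregman.

(** * Contraction of the dispersion by one consensus round *)

Section Dispersion.
Context {R : realType} {n : nat}.
Implicit Types (p : 'I_n -> R) (E : rel 'I_n) (A : 'M[R]_n).

(** Equals 2n times the sum of squared deviations from the mean. Its square root is a seminorm on
    R^n that vanishes exactly on consensus. *)
Definition pair_variance p : R := \sum_i \sum_j (p i - p j) ^+ 2.
Definition dispersion p : R := Num.sqrt (pair_variance p).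

Lemma pair_variance_ge0 p : 0 <= pair_variance p.
Proof. by apply: sumr_ge0 => i _; apply: sumr_ge0 => j _; exact: sqr_ge0. Qed.

Lemma pair_varianceE p :
  pair_variance p = 2 * n%:R * (\sum_i p i ^+ 2) - 2 * (\sum_i p i) ^+ 2.
Proof.
rewrite /pair_variance.
transitivity (\sum_i (n%:R * p i ^+ 2 + \sum_j p j ^+ 2 - 2 * p i * \sum_j p j)).
  apply: eq_bigr => i _.
  transitivity (\sum_(j < n) (p i ^+ 2 + p j ^+ 2 - 2 * p i * p j)).
    by apply: eq_bigr => j _; ring.
  by rewrite !big_split/= sumr_const card_ord sumrN -mulr_sumr -[p i ^+ 2 *+ n]mulr_natl.
rewrite !big_split/= sumr_const card_ord sumrN -mulr_sumr -mulr_suml -mulr_sumr.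
rewrite -[X in _ + X - _]mulr_natl; ring.
Qed.

(** Cauchy-Schwarz, read off from the nonnegativity of [pair_variance]. *)
Lemma sqr_sum_le p : (\sum_i p i) ^+ 2 <= n%:R * \sum_i p i ^+ 2.
Proof. by have := pair_variance_ge0 p; rewrite pair_varianceE; lra. Qed.

Lemma dispersion_ge0 p : 0 <= dispersion p.
Proof. exact: sqrtr_ge0. Qed.

Lemma le_dispersion p i j : `|p i - p j| <= dispersion p.
Proof.
rewrite -sqrtr_sqr; apply: ler_wsqrtr.
rewrite /pair_variance (bigD1 i)//= (bigD1 j)//= -addrA lerDl addr_ge0//.
  by apply: sumr_ge0 => k _; exact: sqr_ge0.
by apply: sumr_ge0 => k _; apply: sumr_ge0 => l _; exact: sqr_ge0.
Qed.

Lemma dispersion_le p c : 0 <= c -> (forall i j, `|p i - p j| <= c) ->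
  dispersion p <= n%:R * c.
Proof.
move=> c0 pc; have nc : 0 <= n%:R * c by rewrite mulr_ge0.
rewrite -[leRHS]ger0_norm// -sqrtr_sqr; apply: ler_wsqrtr.
apply: (@le_trans _ _ (\sum_(i < n) \sum_(j < n) c ^+ 2)).
  apply: ler_sum => i _; apply: ler_sum => j _.
  by rewrite -real_normK ?num_real// lerXn2r// ?nnegrE.
rewrite !sumr_const card_ord le_eqVlt; apply/orP; left; apply/eqP.
by rewrite -mulrnA -[c ^+ 2 *+ _]mulr_natr natrM; ring.
Qed.

Definition mixing A p : 'I_n -> R := fun i => \sum_j A i j * p j.

Section Contraction.
Context {zeta : R} {E : rel 'I_n} {A : 'M[R]_n}.
Hypothesis zeta01 : 0 < zeta < 1.
Hypothesis dsA : doubly_stochastic A.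
Hypothesis wA : weighted_by zeta E A.
Hypothesis scE : strongly_connected E.

Let z0 : 0 < zeta. Proof. by case/andP: zeta01. Qed.
Let A0 i j : 0 <= A i j. Proof. by case: dsA. Qed.

Lemma mixing_sum p : \sum_i mixing A p i = \sum_i p i.
Proof.
rewrite exchange_big/=; apply: eq_bigr => j _.
by rewrite -mulr_suml; case: dsA => _ _ ->; rewrite mul1r.
Qed.

(** The variance of p under the probability weights of row i. *)
Let local_loss p i := \sum_j A i j * (p j - mixing A p i) ^+ 2.

Let local_loss_ge0 p i : 0 <= local_loss p i.
Proof. by apply: sumr_ge0 => j _; rewrite mulr_ge0// sqr_ge0. Qed.

(** Mixing preserves the sum, so only the sum of squares drops: row i loses its local variance, and
    unit column sums turn the averaged squares back into the squares of p. *)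
Lemma pair_variance_loss p : pair_variance p - pair_variance (mixing A p) =
  2 * n%:R * \sum_i local_loss p i.
Proof.
rewrite !pair_varianceE mixing_sum.
have -> : \sum_i local_loss p i = \sum_i p i ^+ 2 - \sum_i mixing A p i ^+ 2.
  have lossE i : local_loss p i = \sum_j A i j * p j ^+ 2 - mixing A p i ^+ 2.
    rewrite /local_loss.
    transitivity (\sum_j (A i j * p j ^+ 2 - 2 * mixing A p i * (A i j * p j)
       + A i j * mixing A p i ^+ 2)); first by apply: eq_bigr => j _; ring.
    rewrite !big_split/= sumrN -mulr_sumr -mulr_suml.
    case: dsA => _ -> _; rewrite -/(mixing A p i); ring.
  rewrite (eq_bigr _ (fun i _ => lossE i)) big_split/= sumrN; congr (_ - _).
  rewrite exchange_big/=; apply: eq_bigr => j _.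
  by rewrite -mulr_suml; case: dsA => _ _ ->; rewrite mul1r.
ring.
Qed.

(** Row j gives weight above zeta both to j itself and to its in-neighbour i; conclude with (a -
    b)^2 <= 2 (a^2 + b^2), centred at the local mean. *)
Let edge_loss p i j : E i j ->
  `|p j - p i| <= Num.sqrt (2 / zeta * local_loss p j).
Proof.
move=> Eij; have c0 : 0 <= 2 / zeta * local_loss p j.
  by rewrite mulr_ge0// divr_ge0// ltW.
rewrite -sqrtr_sqr; apply: ler_wsqrtr.
have [->|ij] := eqVneq i j; first by rewrite subrr expr0n.
have loss_ge : zeta * ((p j - mixing A p j) ^+ 2 + (p i - mixing A p j) ^+ 2) <=
    local_loss p j.
  rewrite /local_loss (bigD1 j)//= (bigD1 i)//= addrA mulrDr.
  rewrite ler_wpDr//; first by apply: sumr_ge0 => k _; rewrite mulr_ge0// sqr_ge0.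
  have [/(_ _) Ajj _] := wA j j; have [/(_ _) Aji _] := wA j i.
  apply: lerD; rewrite ler_wpM2r ?sqr_ge0// ltW//.
    by apply: Ajj; rewrite !inE eqxx.
  by apply: Aji; rewrite !inE Eij orbT.
rewrite -mulrA mulrCA ler_pdivlMl//.
have := mulr_ge0 (ltW z0) (sqr_ge0 (p j - mixing A p j + (p i - mixing A p j))).
lra.
Qed.

(** Telescope along a directed path from j to i. Shortened to distinct vertices, it charges each
    [r k] at most once, and Cauchy-Schwarz bounds the squared sum by n times the sum of squares. *)
Lemma spread_le_loss p i j :
  (p i - p j) ^+ 2 <= n%:R * (2 / zeta * \sum_k local_loss p k).
Proof.
pose r k := Num.sqrt (2 / zeta * local_loss p k).
have H s i0 : path E i0 s -> `|p (last i0 s) - p i0| <= \sum_(k <- s) r k.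
  elim: s i0 => [|k s IH] i0 /=; first by rewrite big_nil subrr normr0.
  move=> /andP[Eik ps]; rewrite big_cons [r k + _]addrC.
  have -> : p (last k s) - p i0 = (p (last k s) - p k) + (p k - p i0).
    by rewrite subrKA.
  rewrite (le_trans (ler_normD _ _))// lerD//; first exact: IH.
  exact: edge_loss.
have /connectP[s0 ps0 ->] := scE j i.
case/shortenP: ps0 => s ps us _.
apply: (@le_trans _ _ ((\sum_k r k) ^+ 2)).
  rewrite -real_normK ?num_real// lerXn2r// ?nnegrE//.
    by apply: sumr_ge0 => k _; exact: sqrtr_ge0.
  apply: (le_trans (H _ _ ps)).
  rewrite big_uniq/=; last by case/andP: us.
  rewrite [leRHS](bigID (mem s))/= lerDl.
  by apply: sumr_ge0 => k _; exact: sqrtr_ge0.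
apply: (le_trans (sqr_sum_le _)); rewrite ler_wpM2l// mulr_sumr.
apply: ler_sum => k _; rewrite /r sqr_sqrtr//.
by rewrite mulr_ge0// divr_ge0// ltW.
Qed.

Lemma sigma1_bounds : (0 < n)%N -> 0 < sigma1 n zeta < 1.
Proof.
move=> n0; rewrite /sigma1; have n1 : 1 <= n%:R :> R by rewrite ler1n.
have d0 : 0 < 4 * n%:R ^+ 2 :> R by rewrite mulr_gt0// exprn_gt0// ltr0n.
rewrite subr_gt0 ltrBlDr ltrDl divr_gt0// andbT ltr_pdivrMr// mul1r.
case/andP: zeta01 => _ z1; apply: (lt_le_trans z1).
by rewrite expr2; nra.
Qed.

(** Summing [spread_le_loss] over the n^2 pairs shows that one round loses at least the fraction
    zeta / n^2 of the pair variance. With y = zeta / (4 n^2), the remaining fraction is at most 1 -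
    4y, below 1 - 2y and hence below (1 - y)^2, the square of [sigma1]. *)
Lemma dispersion_mixing p : dispersion (mixing A p) <= sigma1 n zeta * dispersion p.
Proof.
have [n0|n_gt0] := posnP n.
  rewrite /dispersion /pair_variance !big1 ?sqrtr0 ?mulr0// => i;
    by have := ltn_ord i; rewrite [X in (_ < X)%N]n0.
have nR : 0 < n%:R :> R by rewrite ltr0n.
have [s_gt0 _] := andP (sigma1_bounds n_gt0).
rewrite /dispersion -[sigma1 n zeta]ger0_norm ?(ltW s_gt0)// -sqrtr_sqr.
rewrite -sqrtrM ?sqr_ge0//; apply: ler_wsqrtr.
set V := pair_variance p; set S := \sum_k local_loss p k.
have VS : zeta / n%:R ^+ 2 * V <= 2 * n%:R * S.
  have : V <= \sum_(i < n) \sum_(j < n) n%:R * (2 / zeta * S).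
    by apply: ler_sum => i _; apply: ler_sum => j _; exact: spread_le_loss.
  rewrite !sumr_const card_ord -mulrnA -[_ *+ (n * n)]mulr_natl natrM => h.
  rewrite mulrAC ler_pdivrMr ?exprn_gt0// -ler_pdivlMl//; apply: (le_trans h).
  rewrite le_eqVlt; apply/orP; left; apply/eqP; field; exact: lt0r_neq0.
have -> : pair_variance (mixing A p) = V - 2 * n%:R * S.
  by rewrite -pair_variance_loss /V; ring.
have V0 : 0 <= V by exact: pair_variance_ge0.
have z4 : 0 <= zeta / (4 * n%:R ^+ 2).
  by rewrite divr_ge0 ?(ltW z0)// mulr_ge0// exprn_ge0.
have -> : sigma1 n zeta ^+ 2 * V =
    V - 2 * (zeta / (4 * n%:R ^+ 2)) * V + (zeta / (4 * n%:R ^+ 2)) ^+ 2 * V.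
  by rewrite /sigma1; ring.
have := mulr_ge0 z4 V0.
have -> : zeta / (4 * n%:R ^+ 2) * V = zeta / n%:R ^+ 2 * V / 4.
  by field; exact: lt0r_neq0.
have := mulr_ge0 (sqr_ge0 (zeta / (4 * n%:R ^+ 2))) V0.
have : 2 * (zeta / (4 * n%:R ^+ 2)) * V = zeta / n%:R ^+ 2 * V / 2.
  by field; exact: lt0r_neq0.
lra.
Qed.

End Contraction.
End Dispersion.

(** * Consensus error and mirror descent along a trajectory *)

Section Spread.
Context {R : realType} {n d : nat} {N : 'cV[R]_d -> R}.
Hypothesis hN : is_norm N.
Implicit Types (x e : 'I_n -> 'cV[R]_d).

(* A bound on the projective tensor norm of x in R^n (x) R^d modulo consensus:
   scalar contraction estimates on R^n transfer to an arbitrary norm on R^d. *)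
Definition spread (a : R) x : Prop :=
  exists u0 (l : seq (('I_n -> R) * 'cV[R]_d)),
    (forall i, x i = u0 + \sum_(c <- l) c.1 i *: c.2) /\
    \sum_(c <- l) dispersion c.1 * N c.2 <= a.

Lemma spread_dist a x i j : spread a x -> N (x i - x j) <= a.
Proof.
move=> [u0 [l [xE la]]]; apply: le_trans la.
rewrite !xE opprD addrACA subrr add0r -sumrB.
apply: (le_trans (normv_sum hN _ _)); apply: ler_sum => c _.
by rewrite -scalerBl (norm_scale hN) ler_wpM2r ?(normv_ge0 hN)// le_dispersion.
Qed.

Lemma spread_mulmx (B : 'M[R]_d) a x : (forall u, N (B *m u) <= N u) ->
  spread a x -> spread a (fun i => B *m x i).
Proof.
move=> B1 [u0 [l [xE la]]]; exists (B *m u0), [seq (c.1, B *m c.2) | c <- l].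
split=> [i|].
  rewrite xE mulmxDr mulmx_sumr big_map; congr (_ + _).
  by apply: eq_bigr => c _; rewrite -scalemxAr.
rewrite big_map; apply: le_trans la; apply: ler_sum => c _ /=.
by rewrite ler_wpM2l// dispersion_ge0.
Qed.

(** The perturbation is a sum of tensors of the indicator of k with [e k], and an indicator has
    dispersion at most n. *)
Lemma spread_add a x e : spread a x ->
  spread (a + n%:R * \sum_i N (e i)) (fun i => x i + e i).
Proof.
move=> [u0 [l [xE la]]].
exists u0, (l ++ [seq ((fun i => (i == k)%:R), e k) | k <- index_enum 'I_n]).
split=> [i|].
  rewrite xE big_cat/= big_map -addrA; congr (_ + (_ + _)).
  rewrite (bigD1 i)//= eqxx scale1r big1 ?addr0// => k.
  by rewrite eq_sym => /negbTE ->; rewrite scale0r.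
rewrite big_cat/= big_map lerD// mulr_sumr; apply: ler_sum => k _ /=.
rewrite ler_wpM2r ?(normv_ge0 hN)//.
rewrite -[leRHS]mulr1; apply: dispersion_le => // i j.
by case: (i == k); case: (j == k); rewrite ?subrr ?subr0 ?sub0r ?normrN1 ?normr0 ?normr1.
Qed.

(** View x as a perturbation of the constant configuration at one agent, whose spread is 0. *)
Lemma spread_diam D x : (forall i j, N (x i - x j) <= D) ->
  spread (n%:R * (n%:R * D)) x.
Proof.
move=> xD; have [n0|n_gt0] := posnP n.
  exists 0, [::]; split=> [i|]; last by rewrite big_nil [X in X%:R]n0 mul0r.
  by have := ltn_ord i; rewrite [X in (_ < X)%N]n0.
pose i0 := Ordinal n_gt0.
have s0 : spread 0 (fun _ : 'I_n => x i0).
  by exists (x i0), [::]; split=> [i|]; rewrite big_nil ?addr0.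
have [u0 [l [xE la]]] := spread_add (fun i => x i - x i0) s0.
exists u0, l; split=> [i|]; first by rewrite -xE addrC subrK.
apply: (le_trans la); rewrite add0r ler_wpM2l//.
apply: (@le_trans _ _ (\sum_(i < n) D)); first by apply: ler_sum => i _; exact: xD.
by rewrite sumr_const card_ord mulr_natl.
Qed.

End Spread.
Arguments spread {R n d} N a x.

Section Consensus.
Context {R : realType} {n d : nat} {zeta : R} {E : rel 'I_n} {A : 'M[R]_n}.
Hypothesis dsA : doubly_stochastic A.
Hypothesis wA : weighted_by zeta E A.
Implicit Types (x : 'I_n -> 'cV[R]_d).

Lemma consensusS k x i : consensus E A k.+1 x i = \sum_j A i j *: consensus E A k x j.
Proof.
rewrite /consensus iterS big_mkcond/=; apply: eq_bigr => j _.
case: ifPn => // jN; have [_ /(_ jN) ->] := wA i j.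
by rewrite scale0r.
Qed.

Lemma consensus_in (X : set 'cV[R]_d) k x :
  convex_set (X : set (convex_lmodType 'cV[R]_d)) ->
  (forall i, X (x i)) -> forall i, X (consensus E A k x i).
Proof.
move=> cX Xx; elim: k => [//|k IH] i; rewrite consensusS.
by case: dsA => A0 A1 _; apply: convex_set_sum.
Qed.

(** Unit row sums allow separate convexity at each agent; unit column sums restore the total after
    exchanging the sums. *)
Lemma bregman_consensus Rg k x a : bregman_separately_convex n Rg ->
  \sum_i bregman Rg a (consensus E A k x i) <= \sum_i bregman Rg a (x i).
Proof.
move=> sc; elim: k => [//|k IH]; apply: le_trans IH.
case: dsA => A0 A1 A2.
apply: (@le_trans _ _ (\sum_i \sum_j A i j * bregman Rg a (consensus E A k x j))).
  by apply: ler_sum => i _; rewrite consensusS; apply: sc.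
rewrite exchange_big/=; apply: ler_sum => j _.
by rewrite -mulr_suml A2 mul1r.
Qed.

(** A round acts only on the scalar factors of the tensors, through [mixing]; the vector factors and
    the base point u0 stay fixed. *)
Lemma spread_consensus N a k x : is_norm N -> (0 < n)%N -> 0 < zeta < 1 -> strongly_connected E ->
  spread N a x -> spread N (sigma1 n zeta ^+ k * a) (consensus E A k x).
Proof.
move=> hN n_gt0 z01 scE sx; elim: k => [|k [u0 [l [xE la]]]]; first by rewrite mul1r.
exists u0, [seq (mixing A c.1, c.2) | c <- l]; split=> [i|].
  rewrite consensusS (eq_bigr _ (fun j _ => congr1 _ (xE j))).
  under eq_bigr do rewrite scalerDr.
  rewrite big_split/= -scaler_suml; case: dsA => _ -> _; rewrite scale1r big_map.
  congr (_ + _); under eq_bigr do rewrite scaler_sumr.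
  rewrite exchange_big/=; apply: eq_bigr => c _.
  by rewrite /mixing scaler_suml; apply: eq_bigr => j _; rewrite scalerA.
have [s0 _] := andP (sigma1_bounds z01 n_gt0).
rewrite exprS -mulrA big_map/=.
apply: le_trans (ler_wpM2l (ltW s0) la).
rewrite mulr_sumr; apply: ler_sum => c _ /=.
by rewrite mulrA ler_wpM2r ?(normv_ge0 hN)// (dispersion_mixing z01 dsA wA scE).
Qed.

End Consensus.

Lemma ler_sum_nat_cond (R : numDomainType) (a b : nat) (F G : nat -> R) :
  (forall t, (a <= t < b)%N -> F t <= G t) ->
  \sum_(a <= t < b) F t <= \sum_(a <= t < b) G t.
Proof.
by move=> FG; rewrite big_nat [leRHS]big_nat; apply: ler_sum.
Qed.

Section ConsensusError.
Context {R : realType} {n d : nat} {N : 'cV[R]_d -> R}.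
Hypothesis hN : is_norm N.
Hypothesis n_gt0 : (0 < n)%N.
Context {zeta : R} {E : nat -> rel 'I_n} {A : nat -> 'M[R]_n} {K : nat -> nat}.
Context {B : nat -> 'M[R]_d} {T Kmin : nat}.
Hypothesis zeta01 : 0 < zeta < 1.
Hypothesis dsA : forall t, (1 <= t <= T)%N -> doubly_stochastic (A t).
Hypothesis wA : forall t, (1 <= t <= T)%N -> weighted_by zeta (E t) (A t).
Hypothesis scE : forall t, (1 <= t <= T)%N -> strongly_connected (E t).
Hypothesis KminK : forall t, (1 <= t <= T)%N -> (Kmin <= K t)%N.
Hypothesis Kmin_gt0 : (0 < Kmin)%N.
Hypothesis B1 : forall t, (1 <= t <= T)%N -> forall u, N (B t *m u) <= N u.
Context {x xt : 'I_n -> nat -> 'cV[R]_d} {e : nat -> R} {D : R}.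
Hypothesis xS : forall i t, (1 <= t <= T)%N ->
  x i t.+1 = consensus (E t) (A t) (K t) (fun j => B t *m xt j t) i.
Hypothesis x1D : forall i j, N (x i 1 - x j 1) <= D.
Hypothesis eN : forall t, (1 <= t <= T)%N -> \sum_i N (xt i t - x i t) <= e t.

Let q := sigma1 n zeta ^+ Kmin.

Let sig01 : 0 < sigma1 n zeta < 1. Proof. exact: sigma1_bounds. Qed.

Lemma sigma1_pow_bounds : 0 < q < 1.
Proof.
case/andP: sig01 => s0 s1; rewrite exprn_gt0//=.
by rewrite exprn_ilt1// ?ltW// -lt0n.
Qed.

(** Index shift: [a t] bounds the spread of the decisions of time t + 1, so [a 0] comes from the
    initial diameter. *)
Let a := fix a t := if t is t'.+1 then q * (a t' + n%:R * e t) else n%:R * (n%:R * D).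

Lemma spread_run t : (t <= T)%N -> spread N (a t) (fun i => x i t.+1).
Proof.
elim: t => [_|t IH tT]; first exact: spread_diam.
have t1 : (1 <= t.+1 <= T)%N by [].
have /andP[q0 q1] := sigma1_pow_bounds; have /andP[s0 s1] := sig01.
have := spread_add hN (fun i => xt i t.+1 - x i t.+1) (IH (ltnW tT)).
move=> /(spread_mulmx (B1 t1)).
move=> /(spread_consensus (dsA t1) (wA t1) (K t.+1) hN n_gt0 zeta01 (scE t1)).
set b := a t + _ => -[u0 [l [xE la]]]; exists u0, l; split=> [i|].
  rewrite xS// -xE; congr (consensus _ _ _ _ _); apply/funext => j.
  by rewrite [x j _ + _]addrC subrK.
have p0 : 0 < sigma1 n zeta ^+ K t.+1 by rewrite exprn_gt0.
(* The sign of b is needed to weaken the contraction from K t.+1 rounds to Kmin; it follows from b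
   bounding a sum of nonnegative terms. *)
have b0 : 0 <= b.
  rewrite -(pmulr_rge0 _ p0); apply: le_trans la; apply: sumr_ge0 => c _.
  by rewrite mulr_ge0 ?dispersion_ge0// (normv_ge0 hN).
apply: (le_trans la); apply: (@le_trans _ _ (q * b)).
  rewrite ler_wpM2r// ler_wiXn2l//; [exact: ltW|exact: ltW|exact: KminK].
by rewrite /= ler_wpM2l ?(ltW q0)// lerD2l ler_wpM2l// eN.
Qed.

Let e0 t : (1 <= t <= T)%N -> 0 <= e t.
Proof.
by move=> t1; apply: le_trans (eN t1); apply: sumr_ge0 => i _; exact: normv_ge0.
Qed.

(** Instead of unrolling the recursion for [a], sum it over all rounds: S <= n^2 D + q S + q n (sum
    of e), which is solved for S. *)
Lemma sum_consensus_error i j :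
  \sum_(1 <= t < T.+1) N (x i t - x j t) <=
    (n%:R * (n%:R * D) + q * (n%:R * \sum_(1 <= t < T.+1) e t)) / (1 - q).
Proof.
have /andP[q0 q1] := sigma1_pow_bounds.
have D0 : 0 <= D by apply: le_trans (x1D i j); exact: normv_ge0.
have a_ge0 t : (t <= T)%N -> 0 <= a t.
  elim: t => [_|t IH tT] /=; first by rewrite !mulr_ge0.
  by rewrite mulr_ge0 ?(ltW q0)// addr_ge0 ?IH ?(ltnW tT)// mulr_ge0// e0.
apply: (@le_trans _ _ (\sum_(1 <= t < T.+1) a t.-1)).
  apply: ler_sum_nat_cond => -[//|t] tT.
  exact: (@spread_dist _ _ _ _ hN _ (x^~ t.+1) i j (spread_run (ltnW (tT : (t < T)%N)))).
rewrite big_add1/= [in leRHS]big_add1/=.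
rewrite ler_pdivlMr ?subr_gt0// mulrBr mulr1 lerBlDr.
have rec m : (m <= T)%N -> \sum_(0 <= t < m.+1) a t =
    n%:R * (n%:R * D) + q * \sum_(0 <= t < m) a t
      + q * (n%:R * \sum_(0 <= t < m) e t.+1).
  move=> _; rewrite big_nat_recl//= -mulr_sumr big_split/= -mulr_sumr; ring.
(* One extra nonnegative term, so that the summed recursion applies. *)
apply: (@le_trans _ _ (\sum_(0 <= t < T.+1) a t)).
  by rewrite [leRHS]big_nat_recr//= lerDl a_ge0.
by rewrite rec//; lra.
Qed.

End ConsensusError.

Section MirrorRegret.
Context {R : realType} {n d : nat} {N : 'cV[R]_d -> R}.
Hypothesis hN : is_norm N.
Context {X : set 'cV[R]_d} {rho Psi KX : R} {Rg : 'cV[R]_d -> R}.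
Hypothesis cX : convex_set (X : set (convex_lmodType 'cV[R]_d)).
Hypothesis rho0 : 0 < rho.
Hypothesis dR : forall u, differentiable (Rg : _ -> R^o) u.
Hypothesis sR : strongly_convex_on N X rho Rg.
Hypothesis KXR : bregman_lipschitz N X Rg KX.
Hypothesis PsiR : forall a b, X a -> X b -> bregman Rg a b <= Psi.
Hypothesis scR : bregman_separately_convex n Rg.
Context {zeta : R} {E : nat -> rel 'I_n} {A : nat -> 'M[R]_n} {K : nat -> nat}.
Context {B : nat -> 'M[R]_d} {T : nat} {alpha : nat -> R}.
Hypothesis dsA : forall t, (1 <= t <= T)%N -> doubly_stochastic (A t).
Hypothesis wA : forall t, (1 <= t <= T)%N -> weighted_by zeta (E t) (A t).
Hypothesis B1 : forall t, (1 <= t <= T)%N -> admissible_prediction N X Rg (B t).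
Hypothesis alpha_gt0 : forall t, (1 <= t)%N -> 0 < alpha t.
Hypothesis alpha_noninc : forall t, (1 <= t)%N -> alpha t.+1 <= alpha t.
Context {x z xt g : 'I_n -> nat -> 'cV[R]_d} {u : nat -> 'cV[R]_d}.
Hypothesis x1X : forall i, X (x i 1).
Hypothesis uX : forall t, (1 <= t)%N -> X (u t).
Hypothesis xz : forall i t, (1 <= t <= T)%N ->
  grad Rg (z i t) = grad Rg (x i t) - alpha t *: g i t.
Hypothesis xtz : forall i t, (1 <= t <= T)%N ->
  bregman_projection Rg X (z i t) (xt i t).
Hypothesis xS : forall i t, (1 <= t <= T)%N ->
  x i t.+1 = consensus (E t) (A t) (K t) (fun j => B t *m xt j t) i.

Lemma run_feasible i t : (1 <= t <= T.+1)%N -> X (x i t).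
Proof.
case: t i => [//|[//|t]] i /andP[_ tT]; have t1 : (1 <= t.+1 <= T)%N by [].
rewrite xS//; apply: (consensus_in (dsA t1) (wA t1)) => // j.
have [_ _] := B1 t1; apply; by case: (xtz j t1).
Qed.

Let Phi t := \sum_i bregman Rg (u t) (x i t).

Let Phi_step t : (1 <= t <= T)%N ->
  \sum_i dotv (g i t) (x i t - u t) <=
    (alpha t)^-1 * (Phi t - Phi t.+1)
    + n%:R * `|KX| * (alpha t)^-1 * N (u t.+1 - B t *m u t)
    + alpha t / (2 * rho) * \sum_i dual_norm N (g i t) ^+ 2.
Proof.
move=> t1; have at0 : 0 < alpha t by apply: alpha_gt0; case/andP: t1.
have Xt i : X (x i t) by apply: run_feasible; case/andP: t1 => -> /= /leqW.
have Xt1 i : X (x i t.+1) by apply: run_feasible; case/andP: t1.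
have Xxt i : X (xt i t) by case: (xtz i t1).
have [t_gt0 tT] := andP t1; have Xu := uX t_gt0.
have [Bbr Bop BX] := B1 t1.
have h1 : \sum_i alpha t * dotv (g i t) (x i t - u t) <=
    \sum_i (bregman Rg (u t) (x i t) - bregman Rg (u t) (xt i t)
       + alpha t ^+ 2 * dual_norm N (g i t) ^+ 2 / (2 * rho)).
  apply: ler_sum => i _.
  exact: (mirror_step_regret hN cX rho0 dR sR at0 (xz i t1) (xtz i t1)).
(* From xt to the next potential: replace u t.+1 by B t *m u t at Lipschitz cost, drop the consensus
   rounds, then cancel B t by its nonexpansiveness. KX carries no sign hypothesis, hence the
   absolute value. *)
have h2 : Phi t.+1 <= \sum_i bregman Rg (u t) (xt i t)
    + n%:R * (`|KX| * N (u t.+1 - B t *m u t)).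
  apply: (@le_trans _ _ (\sum_i (bregman Rg (B t *m u t) (x i t.+1)
      + `|KX| * N (u t.+1 - B t *m u t)))).
    apply: ler_sum => i _; rewrite -lerBlDl (le_trans (ler_norm _))//.
    apply: (le_trans (KXR (uX (ltn0Sn t)) (BX _ Xu) (Xt1 i))).
    by rewrite ler_wpM2r ?(normv_ge0 hN)// ler_norm.
  rewrite big_split/= sumr_const card_ord -[_ *+ n]mulr_natl lerD2r.
  under eq_bigr do rewrite xS//.
  apply: (le_trans (bregman_consensus (dsA t1) (wA t1) _ _ _ scR)).
  by apply: ler_sum => i _; exact: Bbr.
rewrite -(ler_pM2l at0) [leLHS]mulr_sumr (le_trans h1)//.
rewrite big_split/= sumrB -/(Phi t).
have -> : alpha t * ((alpha t)^-1 * (Phi t - Phi t.+1) +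
    n%:R * `|KX| * (alpha t)^-1 * N (u t.+1 - B t *m u t) +
    alpha t / (2 * rho) * \sum_i dual_norm N (g i t) ^+ 2) =
  Phi t - Phi t.+1 + n%:R * (`|KX| * N (u t.+1 - B t *m u t)) +
  \sum_i alpha t ^+ 2 * dual_norm N (g i t) ^+ 2 / (2 * rho).
  rewrite -mulr_suml -mulr_sumr; field.
  by rewrite !gt_eqF.
lra.
Qed.

Let Phi_le t : (1 <= t <= T.+1)%N -> Phi t <= n%:R * Psi.
Proof.
move=> t1; apply: (@le_trans _ _ (\sum_(i < n) Psi)).
  apply: ler_sum => i _; apply: PsiR; [by apply: uX; case/andP: t1|exact: run_feasible].
by rewrite sumr_const card_ord mulr_natl.
Qed.

(** Summation by parts with nondecreasing weights 1 / alpha. Keeping [- Phi m.+1] in the bound lets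
    the next increase of the weight multiply the nonnegative n * Psi - Phi. *)
Let Phi_telescope m : (1 <= m <= T)%N ->
  \sum_(1 <= t < m.+1) (alpha t)^-1 * (Phi t - Phi t.+1) <=
    (alpha m)^-1 * (n%:R * Psi - Phi m.+1).
Proof.
elim: m => [//|[|m] IH] mT.
  rewrite big_nat1 ler_wpM2l ?invr_ge0 ?(ltW (alpha_gt0 _))//.
  by rewrite lerD2r; exact: Phi_le.
have /andP[_ m1] := mT.
have {}IH := IH (ltnW m1 : (1 <= m.+1 <= T)%N).
rewrite big_nat_recr//=.
have P1 := @Phi_le m.+2 (ltnW m1 : (1 <= m.+2 <= T.+1)%N).
have a1 : (alpha m.+1)^-1 <= (alpha m.+2)^-1.
  by rewrite lef_pV2 ?posrE ?alpha_gt0// alpha_noninc.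
have : 0 <= ((alpha m.+2)^-1 - (alpha m.+1)^-1) * (n%:R * Psi - Phi m.+2).
  by rewrite mulr_ge0// subr_ge0.
move: IH; rewrite !mulrBr !mulrBl; lra.
Qed.

Lemma alpha_antitone s t : (1 <= s)%N -> (s <= t)%N -> alpha t <= alpha s.
Proof.
move=> s1; elim: t => [|t IH]; first by rewrite leqn0 => /eqP ->.
rewrite leq_eqVlt => /predU1P[->//|st].
apply: le_trans (IH st); apply: alpha_noninc; exact: leq_trans s1 st.
Qed.

Lemma mirror_regret : (1 <= T)%N ->
  \sum_(1 <= t < T.+1) \sum_i dotv (g i t) (x i t - u t) <=
    (alpha T)^-1 * (n%:R * (Psi + `|KX| * path_length N B u T))
    + (2 * rho)^-1 * \sum_(1 <= t < T.+1) alpha t * \sum_i dual_norm N (g i t) ^+ 2.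
Proof.
move=> T1; apply: (le_trans (ler_sum_nat_cond (F := fun t => \sum_i dotv (g i t) (x i t - u t)) _)).
  by move=> t t1; exact: (Phi_step t1).
rewrite !big_split/=.
have PT : 0 <= Phi T.+1.
  apply: sumr_ge0 => i _; apply: (bregman_ge0 rho0 dR sR); first exact: uX.
  by apply: run_feasible; rewrite /= leqnn.
have aT : 0 < (alpha T)^-1 by rewrite invr_gt0 alpha_gt0.
have h1 := @Phi_telescope T; rewrite T1 leqnn in h1; have {}h1 := h1 isT.
have h2 : \sum_(1 <= t < T.+1) n%:R * `|KX| * (alpha t)^-1 * N (u t.+1 - B t *m u t)
    <= (alpha T)^-1 * (n%:R * (`|KX| * path_length N B u T)).
  have -> : (alpha T)^-1 * (n%:R * (`|KX| * path_length N B u T)) =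
      \sum_(1 <= t < T.+1) n%:R * `|KX| * (alpha T)^-1 * N (u t.+1 - B t *m u t).
    by rewrite -mulr_sumr /path_length; ring.
  apply: ler_sum_nat_cond => t /andP[t1 tT].
  rewrite ler_wpM2r ?(normv_ge0 hN)// ler_wpM2l ?mulr_ge0//.
  by rewrite lef_pV2 ?posrE ?alpha_gt0// alpha_antitone.
have h3 : \sum_(1 <= t < T.+1) alpha t / (2 * rho) * (\sum_i dual_norm N (g i t) ^+ 2)
  = (2 * rho)^-1 * \sum_(1 <= t < T.+1) alpha t * \sum_i dual_norm N (g i t) ^+ 2.
  by rewrite mulr_sumr; apply: eq_bigr => t _; rewrite mulrAC mulrC.
have h4 := mulr_ge0 (ltW aT) PT.
rewrite h3; move: h1; rewrite !mulrBr !mulrDr; lra.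
Qed.

Lemma mirror_run_move i t : (1 <= t <= T)%N ->
  N (xt i t - x i t) <= alpha t * dual_norm N (g i t) / rho.
Proof.
move=> t1; have at0 : 0 < alpha t by apply: alpha_gt0; case/andP: t1.
have Xt : X (x i t) by apply: run_feasible; case/andP: t1 => -> /= /leqW.
exact: (mirror_step_move hN cX rho0 dR sR (ltW at0) (xz i t1) (xtz i t1)).
Qed.

End MirrorRegret.

(** * Means and conditional expectations *)

Section Mean.
Context {R : realType} {disp : measure_display} {Omega : measurableType disp}.
Variable P : probability Omega R.
Implicit Types (Z h : Omega -> R) (r c : R).

(** Bundles integrability with a real value, so that means are computed in R rather than in the
    extended reals. *)
Definition has_mean Z r : Prop :=
  P.-integrable setT (EFin \o Z) /\ (\int[P]_w (Z w)%:E = r%:E)%E.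

Lemma integrable_has_mean Z : P.-integrable setT (EFin \o Z) ->
  exists r, has_mean Z r.
Proof.
move=> iZ; exists (fine (\int[P]_w (Z w)%:E)%E); split => //.
by rewrite fineK//; exact: (integrable_fin_num measurableT iZ).
Qed.

Lemma eq_has_mean Z Z' r : Z =1 Z' -> has_mean Z r -> has_mean Z' r.
Proof. by move=> /funext ->. Qed.

Lemma has_mean_cst r : has_mean (fun=> r) r.
Proof.
split; last by rewrite integral_cst//= probability_setT mule1.
exact: finite_measure_integrable_cst.
Qed.

Lemma has_meanD Z Z' r r' : has_mean Z r -> has_mean Z' r' ->
  has_mean (fun w => Z w + Z' w) (r + r').
Proof.
move=> [iZ EZ] [iZ' EZ']; split.
  exact: (integrableD measurableT iZ iZ').
by rewrite EFinD -EZ -EZ' -(integralD measurableT iZ iZ').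
Qed.

Lemma has_meanZ a Z r : has_mean Z r -> has_mean (fun w => a * Z w) (a * r).
Proof.
move=> [iZ EZ]; split; first exact: (integrableZl measurableT a iZ).
by rewrite EFinM -EZ -(integralZl measurableT iZ).
Qed.

Lemma has_mean_sum (I : eqType) (s : seq I) (F : I -> Omega -> R) (r : I -> R) :
  (forall i, i \in s -> has_mean (F i) (r i)) ->
  has_mean (fun w => \sum_(i <- s) F i w) (\sum_(i <- s) r i).
Proof.
elim: s => [|i s IH] Fr.
  rewrite big_nil; apply: eq_has_mean (has_mean_cst 0) => w.
  by rewrite big_nil.
have Fs j : j \in s -> has_mean (F j) (r j) by move=> js; apply: Fr; rewrite inE js orbT.
rewrite big_cons; have := has_meanD (Fr i (mem_head _ _)) (IH Fs).
by apply: eq_has_mean => w; rewrite big_cons.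
Qed.

Lemma has_mean_sum0 (I : eqType) (s : seq I) (F : I -> Omega -> R) :
  (forall i, i \in s -> has_mean (F i) 0) ->
  has_mean (fun w => \sum_(i <- s) F i w) 0.
Proof. by move=> /has_mean_sum; rewrite big1. Qed.

Lemma le_has_mean Z Z' r r' : (forall w, Z w <= Z' w) ->
  has_mean Z r -> has_mean Z' r' -> r <= r'.
Proof.
move=> ZZ' [iZ EZ] [iZ' EZ']; rewrite -lee_fin -EZ -EZ'.
by apply: le_integral => // w _; rewrite lee_fin.
Qed.

(** The integral of a nonnegative function is a supremum over the simple functions below it. *)
Lemma ge0_le_integral_nomeas (f1 f2 : Omega -> \bar R) :
  (forall w, 0 <= f1 w)%E -> (forall w, f1 w <= f2 w)%E ->
  (\int[P]_w f1 w <= \int[P]_w f2 w)%E.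
Proof.
move=> f1_ge0 f12; have f2_ge0 w : (0 <= f2 w)%E by exact: le_trans (f12 w).
rewrite !ge0_integralTE//; apply: le_ereal_sup => _ [h hf <-].
by exists h => // w; exact: le_trans (f12 w).
Qed.

(* The integral of a non-measurable function is a difference of lower integrals,
   hence monotone: no measurability is needed of the bounded function. *)
Lemma integral_le_nomeas h Z r : (forall w, h w <= Z w) -> has_mean Z r ->
  (\int[P]_w (h w)%:E <= r%:E)%E.
Proof.
move=> hZ [iZ <-]; rewrite integralE [leRHS]integralE; apply: leeB.
  apply: ge0_le_integral_nomeas => // w; apply: (@funepos_le _ _ setT); rewrite ?inE// => v _.
  by rewrite lee_fin.
apply: ge0_le_integral_nomeas => // w; apply: (@funeneg_le _ _ setT); rewrite ?inE// => v _.
by rewrite lee_fin.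
Qed.

Lemma abse_expectation_le h Z Z' r r' c : (forall w, h w <= Z w) ->
  (forall w, - h w <= Z' w) -> has_mean Z r -> has_mean Z' r' ->
  r <= c -> r' <= c -> (`|'E_P[h]| <= c%:E)%E.
Proof.
move=> hZ hZ' EZ EZ' rc r'c; rewrite unlock.
(* The integrable majorant makes the positive part of h finite in the mean, which is what lets the
   integral commute with negation. *)
have h_lt : (\int[P]_w (EFin \o h)^\+ w < +oo)%E.
  have [iZ _] := EZ; apply: le_lt_trans (integral_funepos_lt_pinfty measurableT iZ).
  apply: ge0_le_integral_nomeas => // w; apply: (@funepos_le _ _ setT); rewrite ?inE// => v _.
  by rewrite lee_fin.
have Eh : (\int[P]_w (h w)%:E <= c%:E)%E.
  by apply: le_trans (integral_le_nomeas hZ EZ) _; rewrite lee_fin.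
have ENh : (\int[P]_w (- h w)%:E <= c%:E)%E.
  by apply: le_trans (integral_le_nomeas hZ' EZ') _; rewrite lee_fin.
have NE : (\int[P]_w (- h w)%:E = - \int[P]_w (h w)%:E)%E.
  under eq_integral do rewrite EFinN.
  apply: integralN; apply: ltpinfty_adde_def => //.
  rewrite inE; apply: (@le_lt_trans _ _ 0%E) => //.
  by rewrite leeNl oppe0 integral_ge0.
case: (leP 0%E (\int[P]_w (h w)%:E)%E) => E0; first by rewrite gee0_abs.
by rewrite lte0_abs// -NE.
Qed.

Section ConditionalExpectation.
Variable G : set_system Omega.

Lemma integrable_bounded_mul (xi Z : Omega -> R) (C : R) :
  measurable_fun setT xi -> (forall w, `|xi w| <= C) ->
  P.-integrable setT (EFin \o Z) -> P.-integrable setT (EFin \o (fun w => xi w * Z w)).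
Proof.
move=> mxi xiC iZ.
have bxi : [bounded xi w | w in [set: Omega]].
  exists C; split; first exact: num_real.
  by move=> M CM w _; apply: le_trans (xiC w) _; exact: ltW.
exact: (integrableMr measurableT mxi bxi iZ).
Qed.

Lemma cond_exp_cell Z m D : is_cond_exp P G Z m -> G D -> measurable D ->
  has_mean (fun w => \1_D w * (Z w - m w)) 0.
Proof.
move=> [iZ im _ ZD] GD mD.
have iD (h : Omega -> R) : P.-integrable setT (EFin \o h) ->
    P.-integrable setT (EFin \o (fun w => \1_D w * h w)).
  apply: (@integrable_bounded_mul _ _ 1) => [|w]; first exact/measurable_indicP.
  by rewrite indicE; case: (w \in D); rewrite ?normr1 ?normr0.
have ED h : (\int[P]_w (\1_D w * h w)%:E = \int[P]_(w in D) (h w)%:E)%E.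
  rewrite [RHS]integral_mkcond; apply: eq_integral => w _.
  by rewrite patchE indicE; case: (w \in D); rewrite ?mul1r ?mul0r.
have [a Za] := integrable_has_mean (iD _ iZ).
have [b mb] := integrable_has_mean (iD _ im).
have ab : a = b.
  by apply: EFin_inj; case: Za => _ <-; case: mb => _ <-; rewrite !ED ZD.
have := has_meanD Za (has_meanZ (-1) mb); rewrite ab mulN1r subrr.
by apply: eq_has_mean => w; rewrite mulN1r mulrBr.
Qed.

(** Approximate xi by a step function of mesh delta on the G-measurable level sets [D j]. The step
    function tests Z - m to mean 0 cell by cell, and the error is at most delta * E|Z - m| with
    delta arbitrary. *)
Lemma cond_exp_mul (xi Z m : Omega -> R) (C : R) : is_cond_exp P G Z m ->
  measurable_fun setT xi -> (forall U, measurable U -> G (xi @^-1` U)) ->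
  (forall w, `|xi w| <= C) ->
  has_mean (fun w => xi w * (Z w - m w)) 0.
Proof.
move=> ZmG mxi Gxi xiC; have [iZ im _ _] := ZmG.
pose psi w := Z w - m w.
have ipsi : P.-integrable setT (EFin \o psi) := integrableB measurableT iZ im.
have [r Er] := integrable_has_mean (integrable_bounded_mul mxi xiC ipsi).
have [s Es] : exists s, has_mean (fun w => `|psi w|) s.
  by apply: integrable_has_mean; exact: (integrable_abse ipsi).
suff rs delta : 0 < delta -> `|r| <= delta * s.
  suff r0 : r = 0 by rewrite r0 in Er.
  apply/eqP; rewrite -normr_eq0 eq_le normr_ge0 andbT; apply/ler_addgt0Pl => e e0.
  rewrite addr0; have := rs (e / (`|s| + 1)).
  rewrite divr_gt0 ?ltr_pwDr// => /(_ isT)/le_trans; apply.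
  rewrite mulrAC ler_pdivrMr ?ltr_pwDr// ler_wpM2l ?(ltW e0)//.
  by rewrite (le_trans (ler_norm _))// lerDl.
move=> delta0.
(* Since |xi| <= C, the cell index, the truncation of (xi + C) / delta, is at most that of 2C /
   delta, so M cells suffice. *)
pose M := (Num.truncn (2 * C / delta)).+1.
pose c (j : nat) := - C + j%:R * delta.
pose D (j : nat) := xi @^-1` `[c j, c j.+1[.
have mD j : measurable (D j).
  by rewrite -[D j]setTI; apply: mxi => //; exact: measurable_itv.
have GD j : G (D j) by apply: Gxi; exact: measurable_itv.
have E0 : has_mean (fun w => \sum_(j <- iota 0 M) c j * (\1_(D j) w * psi w)) 0.
  apply: has_mean_sum0 => j _; rewrite -(mulr0 (c j)).
  exact: has_meanZ (cond_exp_cell ZmG (GD j) (mD j)).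
have approx w : `|xi w * psi w - \sum_(j <- iota 0 M) c j * (\1_(D j) w * psi w)| <=
    delta * `|psi w|.
  pose t := (xi w + C) / delta.
  have xiw := xiC w; rewrite ler_norml in xiw; have /andP[xi1 xi2] := xiw.
  have t0 : 0 <= t by rewrite divr_ge0 ?(ltW delta0)//; lra.
  have /andP[jt tj] := truncn_itv t0.
  set j0 := Num.truncn t in jt tj.
  have j0M : j0 \in iota 0 M.
    rewrite mem_iota /= add0n ltnS; apply: le_truncn.
    by rewrite /t ler_pM2r ?invr_gt0//; lra.
  have Dw j : (w \in D j) = (j == j0).
    rewrite eq_sym /j0 truncn_eq// /D /c; apply/idP/idP; rewrite !inE/= in_itv/=.
      by move=> /andP[? ?]; rewrite ler_pdivlMr// ltr_pdivrMr//; apply/andP; split; lra.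
    rewrite ler_pdivlMr// ltr_pdivrMr// => /andP[? ?]; apply/andP; split; lra.
  rewrite (bigD1_seq j0) ?iota_uniq//= big1 => [|j /negbTE jj0]; last first.
    by rewrite indicE Dw jj0 mul0r mulr0.
  rewrite indicE Dw eqxx mul1r addr0 -mulrBl normrM ler_wpM2r//.
  rewrite ler_pdivlMr// in jt; rewrite ltr_pdivrMr// -natr1 in tj.
  rewrite ler_norml /c; apply/andP; split; lra.
have up : r <= delta * s.
  have := has_meanD E0 (has_meanZ delta Es); rewrite add0r.
  apply: le_has_mean Er => w; have := approx w; rewrite ler_norml => /andP[_]; lra.
have lo : - r <= delta * s.
  have := has_meanD (has_meanZ (-1) E0) (has_meanZ delta Es); rewrite mulr0 add0r.
  have := has_meanZ (-1) Er; rewrite mulN1r.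
  apply: le_has_mean => w; have := approx w; rewrite ler_norml => /andP[+ _]; lra.
by rewrite ler_norml; apply/andP; split; lra.
Qed.

End ConditionalExpectation.
End Mean.

(** * Step sizes, feasible sets and stochastic gradients *)

Section PolynomialStep.
Context {R : realType} {eps gam : R}.
Hypothesis eps0 : 0 < eps.
Hypothesis gam01 : 0 < gam < 1.

Lemma polynomial_step_gt0 t : (1 <= t)%N -> 0 < polynomial_step eps gam t.
Proof. by move=> t1; rewrite mulr_gt0 ?invr_gt0// powR_gt0// ltr0n. Qed.

Lemma polynomial_step_noninc t : (1 <= t)%N ->
  polynomial_step eps gam t.+1 <= polynomial_step eps gam t.
Proof.
move=> t1; have /andP[g0 _] := gam01.
rewrite ler_wpM2l ?invr_ge0 ?(ltW eps0)// !powRN.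
rewrite lef_pV2 ?posrE ?powR_gt0 ?ltr0n//.
by apply: ge0_ler_powR; rewrite ?nnegrE ?ler_nat// ltW.
Qed.

Lemma polynomial_stepV t : (polynomial_step eps gam t)^-1 = eps * t%:R `^ gam.
Proof. by rewrite /polynomial_step powRN invfM !invrK. Qed.

Let p := 1 - gam.

(** Discrete form of (t^p)' = p t^(-gam). With t' = t + 1 and y = p / t', (1 - 1/t')^p <= exp (-y)
    <= 1 / (1 + y) <= 1 - y / 2; the last step, valid on [0,1], causes the factor 1/2. *)
Lemma powR_increment (t : nat) :
  p / 2 * t.+1%:R `^ (- gam) <= t.+1%:R `^ p - t%:R `^ p.
Proof.
have /andP[g0 g1] := gam01; have p0 : 0 < p by rewrite subr_gt0.
have p1 : p < 1 by rewrite ltrBlDr ltrDl.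
case: t => [|t]; first by rewrite !powR1 powR0 ?gt_eqF// subr0; lra.
set s : R := t.+1%:R; set t' : R := t.+2%:R.
have t'0 : 0 < t' by rewrite ltr0n.
have t'1 : 1 <= t' by rewrite ler1n.
have s0 : 0 < s by rewrite ltr0n.
have stE : s = t' - 1 by rewrite /t' -natr1 addrK.
have tpE : t' `^ p = t' * t' `^ (- gam).
  by rewrite powRD ?powRr1 ?ltW// (gt_eqF t'0) implybT.
have sE : s `^ p = t' `^ p * (s / t') `^ p.
  by rewrite -powRM ?divr_ge0 ?ltW// mulrCA divff ?mulr1// gt_eqF.
have pt0 : 0 < p / t' by rewrite divr_gt0.
have pt1 : p / t' <= 1 by rewrite ler_pdivrMr// mul1r (le_trans (ltW p1)).
have st_le : (s / t') `^ p <= 1 - p / t' / 2.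
  rewrite /powR gt_eqF ?divr_gt0//.
  apply: (@le_trans _ _ (expR (- (p / t')))).
    rewrite ler_expR -mulrN ler_wpM2l ?(ltW p0)//.
    have -> : s / t' = 1 + - t'^-1 by rewrite stE mulrBl divff ?gt_eqF// mul1r.
    by apply: le_ln1Dx; rewrite ltrN2 invf_lt1//; rewrite /t' ltr1n.
  rewrite expRN -[_^-1]mul1r ler_pdivrMr ?expR_gt0//.
  move: (p / t') pt0 pt1 => y y0 y1; have e1 := expR_ge1Dx y.
  apply: (@le_trans _ _ ((1 - y / 2) * (1 + y))); first by nra.
  by rewrite ler_wpM2l//; lra.
have : t' `^ p * (s / t') `^ p <= t' `^ p * (1 - p / t' / 2).
  by rewrite ler_wpM2l// powR_ge0.
have -> : t' `^ p * (1 - p / t' / 2) = t' `^ p - p / 2 * t' `^ (- gam).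
  by rewrite mulrBr mulr1 {2}tpE; field; rewrite gt_eqF.
by rewrite sE; lra.
Qed.

Lemma sum_polynomial_step T : \sum_(1 <= t < T.+1) polynomial_step eps gam t <=
  2 / (p * eps) * T%:R `^ p.
Proof.
have /andP[g0 g1] := gam01; have p0 : 0 < p by rewrite subr_gt0.
have H : p / 2 * \sum_(1 <= t < T.+1) t%:R `^ (- gam) <= T%:R `^ p.
  elim: T => [|T IH]; first by rewrite big_nil mulr0 powR_ge0.
  by rewrite big_nat_recr//= mulrDr; have := powR_increment T; lra.
rewrite -mulr_sumr -(ler_pM2l p0) -(ler_pM2l eps0).
have -> : eps * (p * (eps^-1 * \sum_(1 <= t < T.+1) t%:R `^ (- gam))) =
  2 * (p / 2 * \sum_(1 <= t < T.+1) t%:R `^ (- gam)).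
  by field; rewrite gt_eqF.
have -> : eps * (p * (2 / (p * eps) * T%:R `^ p)) = 2 * T%:R `^ p.
  by field; rewrite !gt_eqF.
by rewrite ler_wpM2l.
Qed.

End PolynomialStep.

Section FeasibleSet.
Context {R : realType} {d : nat} {N : 'cV[R]_d -> R}.
Hypothesis hN : is_norm N.
Context {X : set 'cV[R]_d} {M rho KX : R} {Rg : 'cV[R]_d -> R}.
Hypothesis fX : feasible_set N X M.
Hypothesis rho0 : 0 < rho.
Hypothesis dR : distance_generating N X rho Rg.
Hypothesis KXR : bregman_lipschitz N X Rg KX.

(** Since D(v, v) = 0, the Lipschitz hypothesis and the diameter bound every divergence by |KX| * M,
    so [bregman_max] is a true supremum. *)
Lemma bregman_le_max a b : X a -> X b -> bregman Rg a b <= bregman_max Rg X.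
Proof.
move=> Xa Xb; apply: sup_upper_bound; last by exists a => //; exists b.
have [_ _ M0 XM] := fX.
split; first by exists (bregman Rg a b); exists a => //; exists b.
exists (`|KX| * M) => _ [u Xu [v Xv <-]].
have := KXR Xu Xv Xv; rewrite bregmanxx subr0 => /(le_trans (ler_norm _)).
move=> /le_trans; apply; apply: (@le_trans _ _ (`|KX| * N (u - v))).
  by rewrite ler_wpM2r ?(normv_ge0 hN)// ler_norm.
by rewrite ler_wpM2l// XM.
Qed.

(** Replaces the diameter M, on which the final constant must not depend. *)
Lemma diameter_le_max a b : X a -> X b ->
  N (a - b) <= Num.sqrt (2 * bregman_max Rg X / rho).
Proof.
move=> Xa Xb; have [dRg sR] := dR.
rewrite -[leLHS]ger0_norm ?(normv_ge0 hN)// -sqrtr_sqr; apply: ler_wsqrtr.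
rewrite ler_pdivlMr//; have := bregman_strong dRg sR Xa Xb.
by have := bregman_le_max Xa Xb; lra.
Qed.

Lemma feasible_coord_bound : exists C, forall u k, X u -> `|u k 0| <= C.
Proof.
have [_ _ _ XM] := fX; have [C C0 CN] := coord_le_normv hN.
have [[a Xa]|X0] := pselect (X !=set0); last first.
  by exists 0 => u k Xu; exfalso; apply: X0; exists u.
exists (C * (M + N a)) => u k Xu; apply: (le_trans (CN u k)).
rewrite ler_wpM2l//; have := XM _ _ Xu Xa.
by have := normv_triangle3 hN u a 0; rewrite !subr0; lra.
Qed.

End FeasibleSet.

Section StochasticGradient.
Context {R : realType} {disp : measure_display} {Omega : measurableType disp}.
Context {P : probability Omega R} {d : nat} {N : 'cV[R]_d -> R}.
Hypothesis hN : is_norm N.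
Context {G : set_system Omega} {L : R} {g mean : Omega -> 'cV[R]_d}.
Hypothesis GT : G setT.
Hypothesis ub : unbiased_bounded P G N L g mean.

Lemma dual_norm_mean : exists2 s, s <= L ^+ 2 &
  has_mean P (fun w => dual_norm N (g w) ^+ 2) s.
Proof.
have [_ [h [iZ ih _ Zh] hL]] := ub.
have [s Es] := integrable_has_mean iZ.
exists s => //; rewrite -lee_fin; case: Es => _ <-; rewrite Zh//.
have -> : (L ^+ 2)%:E = (\int[P]_w (L ^+ 2)%:E)%E.
  by case: (has_mean_cst P (L ^+ 2)) => _ ->.
have mh : measurable_fun setT (EFin \o h) by exact: measurable_int ih.
(* Only an upper bound on h is known, almost everywhere, so the comparison goes through its positive
   part. *)
rewrite integralE; apply: (@le_trans _ _ (\int[P]_w (EFin \o h)^\+ w)%E).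
  by rewrite -[leRHS]sube0 leeB// integral_ge0.
apply: ae_ge0_le_integral => //.
- exact: measurable_funepos.
- by move=> w _; rewrite lee_fin sqr_ge0.
- by apply: filterS hL => w hw _; rewrite funeposE/= ge_max !lee_fin hw sqr_ge0.
Qed.

(** At a deterministic point the true gradient is a plain mean, and s <= 1 + s^2 bounds its pairing
    by the second moment. This yields the Lipschitz constant of the losses. *)
Lemma unbiased_dotv_le (v u : 'cV[R]_d) : mean = cst v ->
  dotv v u <= (1 + L ^+ 2) * N u.
Proof.
move=> meanE; have [s sL Es] := dual_norm_mean.
have [gm _] := ub.
have Eg l : has_mean P (fun w => g w l 0) (v l 0).
  have [ig _ _ gG] := gm l.
  have [r [_ Er]] := integrable_has_mean ig; split => //.
  rewrite gG// meanE.
  by case: (has_mean_cst P (v l 0)) => _.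
have Edot : has_mean P (fun w => dotv (g w) u) (dotv v u).
  apply: has_mean_sum => l _; rewrite mulrC.
  by apply: eq_has_mean (has_meanZ (u l 0) (Eg l)) => w; rewrite mulrC.
apply: (@le_trans _ _ ((1 + s) * N u)); last first.
  by rewrite ler_wpM2r ?(normv_ge0 hN)// lerD2l.
rewrite mulrC; apply: (le_has_mean _ Edot (has_meanZ (N u) (has_meanD (has_mean_cst P 1) Es))).
move=> w; apply: (le_trans (dotv_le_dual hN _ _)).
rewrite mulrC ler_wpM2l ?(normv_ge0 hN)//.
have := sqr_ge0 (dual_norm N (g w) - 1); have := sqr_ge0 (dual_norm N (g w)); nra.
Qed.

(** Coordinatewise: the random part of x - u is handled by [cond_exp_mul], the constant part by
    testing on the whole space. *)
Lemma unbiased_martingale (x : Omega -> 'cV[R]_d) (u : 'cV[R]_d) (C : R) :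
  (forall l, measurable_fun setT (fun w => x w l 0)) ->
  (forall l U, measurable U -> G ((fun w => x w l 0) @^-1` U)) ->
  (forall w l, `|x w l 0| <= C) ->
  has_mean P (fun w => dotv (g w - mean w) (x w - u)) 0.
Proof.
move=> mx Gx xC; have [gm _] := ub.
apply: has_mean_sum0 => l _.
have := has_meanD (cond_exp_mul (gm l) (mx l) (Gx l) (fun w => xC w l))
  (has_meanZ (- u l 0) (cond_exp_cell (gm l) GT measurableT)).
rewrite mulr0 addr0; apply: eq_has_mean => w; rewrite indicT/= !mxE; ring.
Qed.

End StochasticGradient.

(** * Expected regret of one player *)

Lemma gradN (R : realType) (d : nat) (F : 'cV[R]_d -> R) a :
  differentiable (F : _ -> R^o) a -> grad (fun u => - F u) a = - grad F a.
Proof.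
move=> dF; apply/matrixP => k l; rewrite !mxE.
by rewrite -deriveN//; exact: diff_derivable.
Qed.

Section LossGap.
Context {R : realType} {n d m : nat} {N1 : 'cV[R]_d -> R} {N2 : 'cV[R]_m -> R}.
Hypothesis hN1 : is_norm N1.
Hypothesis hN2 : is_norm N2.
Context {X : set 'cV[R]_d} {Y : set 'cV[R]_m} {f : 'I_n -> 'cV[R]_d -> 'cV[R]_m -> R}.
Context {l1 l2 : R}.
Hypothesis f_lip1 : forall i a b c, X a -> X b -> Y c ->
  `|f i a c - f i b c| <= l1 * N1 (a - b).
Hypothesis f_lip2 : forall i a b c, Y a -> Y b -> X c ->
  `|f i c a - f i c b| <= l2 * N2 (a - b).

(** Agent i's gap at (x j, y j) is compared with its gap at (x i, y i): the first argument moves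
    once, the second twice, at x i and at u, hence the factor 2. *)
Lemma loss_gap (x g : 'I_n -> 'cV[R]_d) (y : 'I_n -> 'cV[R]_m) u Fs j :
  (forall i, X (x i)) -> (forall i, Y (y i)) -> X u ->
  (forall i, f i (x i) (y i) - f i u (y i) <= dotv (g i) (x i - u)) ->
  \sum_i f i u (y j) <= Fs ->
  \sum_i f i (x j) (y j) - Fs <= \sum_i dotv (g i) (x i - u) +
    \sum_i (l1 * N1 (x i - x j) + 2 * l2 * N2 (y i - y j)).
Proof.
move=> Xx Yy Xu fg uF.
apply: (@le_trans _ _ (\sum_i f i (x j) (y j) - \sum_i f i u (y j))).
  by rewrite lerD2l lerN2.
rewrite -sumrB -big_split/=; apply: ler_sum => i _.
have h1 := le_trans (ler_norm _) (f_lip1 i (Xx j) (Xx i) (Yy j)).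
have h2 := le_trans (ler_norm _) (f_lip2 i (Yy j) (Yy i) (Xx i)).
have h3 := le_trans (ler_norm _) (f_lip2 i (Yy i) (Yy j) Xu).
rewrite (normv_distC hN1 (x j)) in h1; rewrite (normv_distC hN2 (y j)) in h2.
have := fg i; lra.
Qed.

End LossGap.

Section OneSide.
Context {R : realType} {disp : measure_display} {Omega : measurableType disp}.
Variable P : probability Omega R.
Context {n d : nat} {N : 'cV[R]_d -> R} {X : set 'cV[R]_d} {M rho L KX : R}.
Context {Rg : 'cV[R]_d -> R}.
Hypothesis hN : is_norm N.
Hypothesis n_gt0 : (0 < n)%N.
Hypothesis fX : feasible_set N X M.
Hypothesis rho0 : 0 < rho.
Hypothesis dR : distance_generating N X rho Rg.
Hypothesis KXR : bregman_lipschitz N X Rg KX.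
Hypothesis scR : bregman_separately_convex n Rg.
Context {zeta : R} {E : nat -> rel 'I_n} {A : nat -> 'M[R]_n} {K : nat -> nat}.
Context {B : nat -> 'M[R]_d} {T Kmin : nat} {alpha : nat -> R}.
Hypothesis T_gt0 : (1 <= T)%N.
Hypothesis zeta01 : 0 < zeta < 1.
Hypothesis dsA : forall t, (1 <= t <= T)%N -> doubly_stochastic (A t).
Hypothesis wA : forall t, (1 <= t <= T)%N -> weighted_by zeta (E t) (A t).
Hypothesis scE : forall t, (1 <= t <= T)%N -> strongly_connected (E t).
Hypothesis KminK : forall t, (1 <= t <= T)%N -> (Kmin <= K t)%N.
Hypothesis Kmin_gt0 : (0 < Kmin)%N.
Hypothesis B1 : forall t, (1 <= t <= T)%N -> admissible_prediction N X Rg (B t).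
Hypothesis alpha_gt0 : forall t, (1 <= t)%N -> 0 < alpha t.
Hypothesis alpha_noninc : forall t, (1 <= t)%N -> alpha t.+1 <= alpha t.
Context {x z xt g : 'I_n -> nat -> Omega -> 'cV[R]_d} {u : nat -> 'cV[R]_d}.
Hypothesis x1X : forall i w, X (x i 1 w).
Hypothesis uX : forall t, (1 <= t)%N -> X (u t).
Hypothesis xz : forall i t w, (1 <= t <= T)%N ->
  grad Rg (z i t w) = grad Rg (x i t w) - alpha t *: g i t w.
Hypothesis xtz : forall i t w, (1 <= t <= T)%N ->
  bregman_projection Rg X (z i t w) (xt i t w).
Hypothesis xS : forall i t w, (1 <= t <= T)%N ->
  x i t.+1 w = consensus (E t) (A t) (K t) (fun j => B t *m xt j t w) i.
Hypothesis gL : forall i t, (1 <= t <= T)%N -> exists2 s, s <= L ^+ 2 &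
  has_mean P (fun w => dual_norm N (g i t w) ^+ 2) s.

(** The added 1 makes each summand dominate both the dual norm and its square, so one random
    variable controls the mirror regret and the consensus error. *)
Definition gradient_energy w :=
  \sum_(1 <= t < T.+1) alpha t * \sum_i (1 + dual_norm N (g i t w) ^+ 2).

Let q := sigma1 n zeta ^+ Kmin.
Let Psi := bregman_max Rg X.

Let cX : convex_set (X : set (convex_lmodType 'cV[R]_d)). Proof. by case: fX. Qed.

Lemma side_feasible i t w : (1 <= t <= T.+1)%N -> X (x i t w).
Proof.
exact: (@run_feasible _ _ _ N X Rg cX zeta E A K B T dsA wA B1
  (fun i t => x i t w) (fun i t => z i t w) (fun i t => xt i t w)
  (fun i => x1X i w) (fun i t => xtz i w) (fun i t => xS i w)).
Qed.

Lemma side_regret w :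
  \sum_(1 <= t < T.+1) \sum_i dotv (g i t w) (x i t w - u t) <=
    (alpha T)^-1 * (n%:R * (Psi + `|KX| * path_length N B u T))
    + (2 * rho)^-1 * gradient_energy w.
Proof.
have [dRg sR] := dR.
apply: le_trans (mirror_regret hN cX rho0 dRg sR KXR
  (fun a b Xa Xb => bregman_le_max hN fX KXR Xa Xb) scR dsA wA B1 alpha_gt0
  alpha_noninc (fun i => x1X i w) uX (fun i t => xz i w) (fun i t => xtz i w)
  (fun i t => xS i w) T_gt0) _.
rewrite lerD2l ler_wpM2l ?invr_ge0 ?mulr_ge0 ?(ltW rho0)//.
apply: ler_sum_nat_cond => t /andP[t1 _]; rewrite ler_wpM2l ?(ltW (alpha_gt0 t1))//.
by apply: ler_sum => i _; rewrite lerDr.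
Qed.

Lemma side_consensus w i j : \sum_(1 <= t < T.+1) N (x i t w - x j t w) <=
  (n%:R * (n%:R * Num.sqrt (2 * Psi / rho)) + q * (n%:R * (gradient_energy w / rho)))
  / (1 - q).
Proof.
have [dRg sR] := dR.
have -> : gradient_energy w / rho = \sum_(1 <= t < T.+1)
    alpha t * (\sum_i (1 + dual_norm N (g i t w) ^+ 2)) / rho.
  by rewrite /gradient_energy mulr_suml.
apply: (@sum_consensus_error _ _ _ N hN n_gt0 zeta E A K B T Kmin zeta01 dsA wA scE
  KminK Kmin_gt0 _ (fun i t => x i t w) (fun i t => xt i t w)) => //.
- by move=> t t1; apply: (op_norm_le1 hN); case: (B1 t1).
- by move=> k t; exact: xS.
- by move=> k l; exact: (diameter_le_max hN fX rho0 dR KXR).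
- move=> t t1; have a0 : 0 <= alpha t by apply/ltW/alpha_gt0; case/andP: t1.
  rewrite -mulrA mulr_suml mulr_sumr; apply: ler_sum => k _.
  apply: (le_trans (mirror_run_move hN cX rho0 dRg sR dsA wA B1 alpha_gt0
    (fun i => x1X i w) (fun i t => xz i w) (fun i t => xtz i w) (fun i t => xS i w) k t1)).
  rewrite -mulrA ler_wpM2l// ler_wpM2r ?invr_ge0 ?(ltW rho0)//.
  have := sqr_ge0 (dual_norm N (g k t w) - 1).
  have := sqr_ge0 (dual_norm N (g k t w)); nra.
Qed.

Lemma side_energy_mean : exists2 s,
  s <= n%:R * (1 + L ^+ 2) * \sum_(1 <= t < T.+1) alpha t &
  has_mean P gradient_energy s.
Proof.
have [s sP] : exists s : 'I_n -> nat -> R, forall i t, (1 <= t <= T)%N ->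
    s i t <= L ^+ 2 /\ has_mean P (fun w => dual_norm N (g i t w) ^+ 2) (s i t).
  have sE (it : 'I_n * nat) : exists s : R, (1 <= it.2 <= T)%N -> s <= L ^+ 2 /\
      has_mean P (fun w => dual_norm N (g it.1 it.2 w) ^+ 2) s.
    case: (boolP (1 <= it.2 <= T)%N) => t1; last by exists 0.
    by have [s sL Es] := gL it.1 t1; exists s.
  have [s sP] := choice sE; exists (fun i t => s (i, t)) => i t t1.
  exact: (sP (i, t) t1).
exists (\sum_(1 <= t < T.+1) alpha t * \sum_i (1 + s i t)).
  rewrite mulr_sumr; apply: ler_sum_nat_cond => t t1.
  rewrite [leRHS]mulrC ler_wpM2l ?(ltW (alpha_gt0 _))//; first by case/andP: t1.
  apply: (@le_trans _ _ (\sum_(i < n) (1 + L ^+ 2))).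
    by apply: ler_sum => i _; rewrite lerD2l; case: (sP i t t1).
  by rewrite sumr_const card_ord mulr_natl.
apply: has_mean_sum => t; rewrite mem_index_iota => t1.
apply: has_meanZ; apply: has_mean_sum => i _.
apply: has_meanD; first exact: has_mean_cst.
by case: (sP i t t1).
Qed.

End OneSide.

(** * Collecting all terms into one constant *)

Section RegretConstant.
Context {R : realType}.

(** D is the diameter bound and kappa the factor of T^(1 - gam) in the mean energy. The absolute
    values keep the constant nonnegative for any real parameters, since it is chosen before the
    sets. *)
Definition regret_constant (n : nat) (gam1 gam2 eps1 eps2 rho1 rho2 Psi1 Psi2 K1 L1 L2 : R) : R :=
  let D rho Psi := Num.sqrt (2 * Psi / rho) in
  let kappa gam eps L := n%:R * (1 + L ^+ 2) * (2 / ((1 - gam) * eps)) in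
  eps1 * (n%:R * (`|Psi1| + `|K1|)) +
  ((2 * rho1)^-1 * kappa gam1 eps1 L1 +
   n%:R * ((1 + L1 ^+ 2) *
             (n%:R * (n%:R * D rho1 Psi1) + n%:R * (kappa gam1 eps1 L1 / rho1)) +
           2 * (1 + L2 ^+ 2) *
             (n%:R * (n%:R * D rho2 Psi2) + n%:R * (kappa gam2 eps2 L2 / rho2)))).


Context {disp : measure_display} {Omega : measurableType disp}.
Variable P : probability Omega R.

Lemma regret_constant_ge0 n gam1 gam2 eps1 eps2 rho1 rho2 Psi1 Psi2 K1 L1 L2 :
  0 < eps1 -> 0 < eps2 -> gam1 < 1 -> gam2 < 1 -> 0 < rho1 -> 0 < rho2 ->
  0 <= regret_constant n gam1 gam2 eps1 eps2 rho1 rho2 Psi1 Psi2 K1 L1 L2.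
Proof.
move=> e1 e2 g1 g2 r1 r2; rewrite /regret_constant.
have ? (L : R) : 0 <= 1 + L ^+ 2 by rewrite addr_ge0// sqr_ge0.
have ? : 0 <= 1 - gam1 by rewrite subr_ge0 ltW.
have ? : 0 <= 1 - gam2 by rewrite subr_ge0 ltW.
have [? ?] := (ltW r1, ltW r2); have [? ?] := (ltW e1, ltW e2).
by do ! first [done | exact: sqrtr_ge0 | apply: addr_ge0 | apply: mulr_ge0
  | rewrite invr_ge0].
Qed.

(** In the application H is the network factor, U and W are T^theta1 and T^theta2, and U1, U2, Tg
    are the corresponding powers for individual step sizes. *)
Lemma mean_regret_bound (h Mart E1 E2 : Omega -> R)
    (n : nat) (gam1 gam2 eps1 eps2 rho1 rho2 Psi1 Psi2 K1 L1 L2 : R)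
    (q H U W V V1 Tg s1 s2 U1 U2 : R)
    (D1 := Num.sqrt (2 * Psi1 / rho1)) (D2 := Num.sqrt (2 * Psi2 / rho2)) :
  0 < eps1 -> 0 < eps2 -> gam1 < 1 -> gam2 < 1 -> 0 < rho1 -> 0 < rho2 ->
  0 < q < 1 -> (1 - q)^-1 <= H -> 0 <= V1 -> V1 <= V -> 0 <= Tg -> Tg <= W ->
  1 <= U -> U1 <= U -> U2 <= U ->
  has_mean P Mart 0 -> has_mean P E1 s1 -> has_mean P E2 s2 ->
  s1 <= n%:R * (1 + L1 ^+ 2) * (2 / ((1 - gam1) * eps1) * U1) ->
  s2 <= n%:R * (1 + L2 ^+ 2) * (2 / ((1 - gam2) * eps2) * U2) ->
  (forall w, h w <= Mart w + ((eps1 * Tg) * (n%:R * (Psi1 + `|K1| * V1))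
     + (2 * rho1)^-1 * E1 w)
     + n%:R * ((1 + L1 ^+ 2) *
          ((n%:R * (n%:R * D1) + q * (n%:R * (E1 w / rho1))) / (1 - q))
        + 2 * (1 + L2 ^+ 2) *
          ((n%:R * (n%:R * D2) + q * (n%:R * (E2 w / rho2))) / (1 - q)))) ->
  exists G r, [/\ forall w, h w <= G w, has_mean P G r &
    r <= regret_constant n gam1 gam2 eps1 eps2 rho1 rho2 Psi1 Psi2 K1 L1 L2 *
       Num.max (H * U) (W * (1 + V))].
Proof.
move=> e1 e2 g1 g2 r1 r2 /andP[q0 q1] qH V10 V1V Tg0 TgW U_ge1 U1U U2U EM EE1 EE2 s1U s2U hG.
set l1 := 1 + L1 ^+ 2 in hG s1U; set l2 := 1 + L2 ^+ 2 in hG s2U.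
have l10 : 0 <= l1 by rewrite addr_ge0// sqr_ge0.
have l20 : 0 <= l2 by rewrite addr_ge0// sqr_ge0.
pose a0 := eps1 * Tg * (n%:R * (Psi1 + `|K1| * V1)) +
  n%:R * (l1 * (n%:R * (n%:R * D1)) + 2 * l2 * (n%:R * (n%:R * D2))) / (1 - q).
pose a1 := (2 * rho1)^-1 + n%:R * (l1 * (q * n%:R / rho1 / (1 - q))).
pose a2 := n%:R * (2 * l2 * (q * n%:R / rho2 / (1 - q))).
pose kap1 := n%:R * l1 * (2 / ((1 - gam1) * eps1)).
pose kap2 := n%:R * l2 * (2 / ((1 - gam2) * eps2)).
exists (fun w => Mart w + a0 + (a1 * E1 w + a2 * E2 w)), (0 + a0 + (a1 * s1 + a2 * s2)).
split=> [w||].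
- apply: (le_trans (hG w)); rewrite le_eqVlt; apply/orP; left; apply/eqP.
  rewrite /a0 /a1 /a2; field.
  by rewrite !gt_eqF// subr_gt0.
- apply: has_meanD; first by apply: has_meanD => //; exact: has_mean_cst.
  by apply: has_meanD; apply: has_meanZ.
set MX := Num.max _ _.
have HU : H * U <= MX by rewrite le_max lexx.
have WV : W * (1 + V) <= MX by rewrite le_max lexx orbT.
have b0 : 0 < (1 - q)^-1 by rewrite invr_gt0 subr_gt0.
have H0 : 0 <= H by apply: le_trans qH; exact: ltW.
have b1 : 1 <= (1 - q)^-1 by rewrite invf_ge1 ?subr_gt0//; lra.
have H1 : 1 <= H := le_trans b1 qH.
have U0 : 0 <= U by apply: le_trans U_ge1.
have UMX : U <= MX by apply: le_trans HU; rewrite ler_peMl.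
have b_MX : (1 - q)^-1 <= MX.
  by apply: (le_trans qH); apply: le_trans HU; rewrite ler_peMr.
have MX0 : 0 <= MX by apply: le_trans UMX.
have kap_ge0 g e l : g < 1 -> 0 < e -> 0 <= l -> 0 <= n%:R * l * (2 / ((1 - g) * e)).
  by move=> g_1 e_0 l0; rewrite !mulr_ge0// invr_ge0 mulr_ge0 ?ltW// subr_gt0.
(* A mean energy enters bare through the mirror regret and with coefficient q / (1 - q) <= H through
   the consensus error; H >= 1 absorbs both. *)
have bound kap s Ui : 0 <= kap -> Ui <= U -> s <= kap * Ui ->
    s <= kap * MX /\ q / (1 - q) * s <= kap * MX.
  move=> kap0 UiU sU; have sU' : s <= kap * U by apply: (le_trans sU); rewrite ler_wpM2l.
  split; first by apply: (le_trans sU'); rewrite ler_wpM2l.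
  have q_b : 0 <= q / (1 - q) by rewrite mulr_ge0 ?ltW.
  apply: (@le_trans _ _ (q / (1 - q) * (kap * U))); first by rewrite ler_wpM2l.
  rewrite mulrCA ler_wpM2l//; apply: le_trans HU; rewrite ler_wpM2r//.
  by apply: le_trans qH; rewrite ler_piMl ?ltW.
have [F1 F1'] : s1 <= kap1 * MX /\ q / (1 - q) * s1 <= kap1 * MX.
  by apply: bound U1U _; [exact: kap_ge0|rewrite -mulrA].
have [F2 F2'] : s2 <= kap2 * MX /\ q / (1 - q) * s2 <= kap2 * MX.
  by apply: bound U2U _; [exact: kap_ge0|rewrite -mulrA].
have D10 : 0 <= D1 by exact: sqrtr_ge0.
have D20 : 0 <= D2 by exact: sqrtr_ge0.
have G0 : eps1 * Tg * (n%:R * (Psi1 + `|K1| * V1)) <=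
    eps1 * (n%:R * (`|Psi1| + `|K1|)) * MX.
  apply: (@le_trans _ _ (eps1 * (n%:R * (`|Psi1| + `|K1|)) * (W * (1 + V)))); last first.
    by rewrite ler_wpM2l// !mulr_ge0 ?addr_ge0// ltW.
  have -> : eps1 * (n%:R * (`|Psi1| + `|K1|)) * (W * (1 + V)) =
    eps1 * (W * (n%:R * ((`|Psi1| + `|K1|) * (1 + V)))) by ring.
  rewrite -mulrA ler_wpM2l ?(ltW e1)//.
  have PV : Psi1 + `|K1| * V1 <= (`|Psi1| + `|K1|) * (1 + V).
    have h1 := ler_norm Psi1; have h2 := ler_wpM2l (normr_ge0 K1) V1V.
    have h3 : 0 <= `|Psi1| * V by rewrite mulr_ge0// (le_trans V10).
    have h4 := normr_ge0 K1; lra.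
  apply: (@le_trans _ _ (Tg * (n%:R * ((`|Psi1| + `|K1|) * (1 + V))))).
    by rewrite ler_wpM2l// ler_wpM2l.
  rewrite ler_wpM2r// !mulr_ge0// addr_ge0//.
  by apply: le_trans V1V.
have G1 : n%:R * (l1 * (n%:R * (n%:R * D1)) + 2 * l2 * (n%:R * (n%:R * D2))) / (1 - q)
    <= n%:R * (l1 * (n%:R * (n%:R * D1)) + 2 * l2 * (n%:R * (n%:R * D2))) * MX.
  rewrite ler_wpM2l//; by do ! first [done | apply: addr_ge0 | apply: mulr_ge0].
have G2 : (2 * rho1)^-1 * s1 <= (2 * rho1)^-1 * (kap1 * MX).
  by rewrite ler_wpM2l// invr_ge0 mulr_ge0// ltW.
have G3 : n%:R * (l1 * (n%:R / rho1)) * (q / (1 - q) * s1) <=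
    n%:R * (l1 * (n%:R / rho1)) * (kap1 * MX).
  by rewrite ler_wpM2l// !mulr_ge0// invr_ge0 ltW.
have G4 : n%:R * (2 * l2 * (n%:R / rho2)) * (q / (1 - q) * s2) <=
    n%:R * (2 * l2 * (n%:R / rho2)) * (kap2 * MX).
  by rewrite ler_wpM2l// !mulr_ge0// invr_ge0 ltW.
have -> : 0 + a0 + (a1 * s1 + a2 * s2) =
  eps1 * Tg * (n%:R * (Psi1 + `|K1| * V1)) +
  n%:R * (l1 * (n%:R * (n%:R * D1)) + 2 * l2 * (n%:R * (n%:R * D2))) / (1 - q) +
  (2 * rho1)^-1 * s1 + n%:R * (l1 * (n%:R / rho1)) * (q / (1 - q) * s1) +
  n%:R * (2 * l2 * (n%:R / rho2)) * (q / (1 - q) * s2).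
  by rewrite /a0 /a1 /a2; field; rewrite !gt_eqF// subr_gt0.
have -> : regret_constant n gam1 gam2 eps1 eps2 rho1 rho2 Psi1 Psi2 K1 L1 L2 * MX =
  eps1 * (n%:R * (`|Psi1| + `|K1|)) * MX +
  n%:R * (l1 * (n%:R * (n%:R * D1)) + 2 * l2 * (n%:R * (n%:R * D2))) * MX +
  (2 * rho1)^-1 * (kap1 * MX) + n%:R * (l1 * (n%:R / rho1)) * (kap1 * MX) +
  n%:R * (2 * l2 * (n%:R / rho2)) * (kap2 * MX).
  by rewrite /regret_constant -/l1 -/l2 -/D1 -/D2 -/kap1 -/kap2; ring.
lra.
Qed.

End RegretConstant.

(** * The saddle point regret *)

(** Splits the true gradient as noise plus stochastic gradient: the noise sum is kept for averaging,
    the rest is bounded pointwise. *)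
Lemma sum_gap_le (R : realType) (n d T : nat) (F : nat -> R)
    (gr g x : 'I_n -> nat -> 'cV[R]_d) (u : nat -> 'cV[R]_d)
    (a b : 'I_n -> nat -> R) (l1 l2 A C1 C2 : R) : 0 <= l1 -> 0 <= l2 ->
  (forall t, (1 <= t <= T)%N -> F t <= \sum_i dotv (gr i t) (x i t - u t) +
      \sum_i (l1 * a i t + 2 * l2 * b i t)) ->
  \sum_(1 <= t < T.+1) \sum_i dotv (g i t) (x i t - u t) <= A ->
  (forall i, \sum_(1 <= t < T.+1) a i t <= C1) ->
  (forall i, \sum_(1 <= t < T.+1) b i t <= C2) ->
  \sum_(1 <= t < T.+1) F t <=
    \sum_(1 <= t < T.+1) \sum_i dotv (gr i t - g i t) (x i t - u t) + A
    + n%:R * (l1 * C1 + 2 * l2 * C2).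
Proof.
move=> l10 l20 FP gA aC bC; apply: (le_trans (ler_sum_nat_cond (a := 1) (b := T.+1) FP)).
rewrite big_split/= lerD//.
  have -> : \sum_(1 <= t < T.+1) \sum_i dotv (gr i t) (x i t - u t) =
      \sum_(1 <= t < T.+1) \sum_i dotv (gr i t - g i t) (x i t - u t) +
      \sum_(1 <= t < T.+1) \sum_i dotv (g i t) (x i t - u t).
    rewrite -big_split; apply: eq_bigr => t _; rewrite -big_split.
    by apply: eq_bigr => i _; rewrite dotvBl/= subrK.
  by rewrite lerD2l.
rewrite exchange_big/=.
apply: (@le_trans _ _ (\sum_(i < n) (l1 * C1 + 2 * l2 * C2))); last first.
  by rewrite sumr_const card_ord -[_ *+ n]mulr_natl.
apply: ler_sum => i _; rewrite big_split/= -!mulr_sumr lerD// ler_wpM2l//.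
by rewrite mulr_ge0.
Qed.

Section History.
Context {R : realType} {disp : measure_display} {Omega : measurableType disp}.
Context {n d m : nat} (r : run R Omega n d m).

Lemma history_setT t : history r t setT.
Proof.
have [h0 hD _] : sigma_algebra setT (history r t) by exact: smallest_sigma_algebra.
by rewrite -(setD0 setT); exact: hD.
Qed.

(** Decisions of index t are computed at the end of round t - 1, and [history] at t - 1 already
    includes them. *)
Lemma history_dec_x i t l (U : set R) : (1 <= t)%N -> measurable U ->
  history r t.-1 ((fun w => dec_x r i t w l 0) @^-1` U).
Proof.
move=> t1 mU; apply: sub_sigma_algebra; left; exists i, t; split.
  by rewrite t1/= leqSpred.
by left; exists l, U.
Qed.

Lemma history_dec_y i t l (U : set R) : (1 <= t)%N -> measurable U ->
  history r t.-1 ((fun w => dec_y r i t w l 0) @^-1` U).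
Proof.
move=> t1 mU; apply: sub_sigma_algebra; left; exists i, t; split.
  by rewrite t1/= leqSpred.
by right; exists l, U.
Qed.

End History.
Arguments history_setT {R disp Omega n d m} r t.
Arguments history_dec_x {R disp Omega n d m} r i t l.
Arguments history_dec_y {R disp Omega n d m} r i t l.

Lemma min_rounds_le (K : nat -> nat) T t : (1 <= t <= T)%N -> (min_rounds K T <= K t)%N.
Proof.
move=> tT; rewrite /min_rounds.
have : t \in index_iota 1 T.+1 by rewrite mem_index_iota.
elim: (index_iota 1 T.+1) => [//|s l IH]; rewrite inE big_cons => /predU1P[->|/IH].
  exact: geq_minl.
by apply: leq_trans; exact: geq_minr.
Qed.

Lemma min_rounds_gt0 (K : nat -> nat) T : (forall t, (0 < t)%N -> (0 < K t)%N) ->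
  (0 < min_rounds K T)%N.
Proof.
move=> K0; rewrite /min_rounds big_nat; elim/big_ind : _ => [|a b a0 b0|t /andP[t1 _]].
- exact: K0.
- by rewrite leq_min a0.
- exact: K0.
Qed.

(** Write 1 / (1 - q) = 1 + q / (1 - q) with q = sigma1^k; the claim becomes sigma1 * sigma1^k <=
    sigma1^(k-1), true as sigma1 < 1. *)
Lemma mixing_factor_le (R : realType) (n k : nat) (zeta : R) :
  (0 < n)%N -> (0 < k)%N -> 0 < zeta < 1 ->
  (1 - sigma1 n zeta ^+ k)^-1 <=
    1 + Gamma1 n zeta * sigma1 n zeta ^+ k.-1 / (1 - sigma1 n zeta ^+ k).
Proof.
move=> n0 k0 z01; have /andP[s0 s1] := sigma1_bounds z01 n0.
have /andP[q0 q1] : 0 < sigma1 n zeta ^+ k < 1.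
  by rewrite exprn_gt0//= exprn_ilt1// ?ltW// -lt0n.
have b0 : 0 < 1 - sigma1 n zeta ^+ k by rewrite subr_gt0.
rewrite [leLHS](_ : _ = 1 + sigma1 n zeta ^+ k / (1 - sigma1 n zeta ^+ k)); last first.
  by field; rewrite gt_eqF.
rewrite lerD2l ler_wpM2r ?invr_ge0 ?(ltW b0)//.
rewrite /Gamma1 -/(sigma1 n zeta) ler_pdivlMl//.
case: k k0 {q0 q1 b0} => [//|k] _; rewrite exprS mulrA ler_piMl ?exprn_ge0 ?(ltW s0)//.
by rewrite mulr_ile1 ?ltW.
Qed.

Theorem corollary2 (R : realType) (n d m : nat)
    (LX LY rhox rhoy KX KY eps1 eps2 gam1 gam2 PsiX PsiY : R)
    (x1 : 'I_n -> 'cV[R]_d) (y1 : 'I_n -> 'cV[R]_m) :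
  0 < rhox -> 0 < rhoy -> 0 < eps1 -> 0 < eps2 ->
  0 < gam1 < 1 -> 0 < gam2 < 1 ->
  let theta1 := Num.max (1 - gam1) (1 - gam2) in
  let theta2 := Num.max gam1 gam2 in
  (* the constant of the O(.) bound *)
  exists2 c : R, 0 < c &
  forall (Nx : 'cV[R]_d -> R) (Ny : 'cV[R]_m -> R)
         (X : set 'cV[R]_d) (Y : set 'cV[R]_m) (MX MY : R)
         (Rx : 'cV[R]_d -> R) (Ry : 'cV[R]_m -> R)
         (f : 'I_n -> nat -> 'cV[R]_d -> 'cV[R]_m -> R)
         (xstar : nat -> 'cV[R]_d) (ystar : nat -> 'cV[R]_m)
         (zeta : R) (E : nat -> rel 'I_n) (A : nat -> 'M[R]_n)
         (K : nat -> nat) (B : nat -> 'M[R]_d) (C : nat -> 'M[R]_m),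
  is_norm Nx -> is_norm Ny ->
  feasible_set Nx X MX -> feasible_set Ny Y MY ->
  (forall i, X (x1 i) /\ Y (y1 i)) ->
  distance_generating Nx X rhox Rx -> distance_generating Ny Y rhoy Ry ->
  bregman_max Rx X = PsiX -> bregman_max Ry Y = PsiY ->
  convex_concave_losses X Y f ->
  (forall t, (0 < t)%N ->
    saddle_point X Y (total_loss f t) (xstar t) (ystar t)) ->
  0 < zeta < 1 ->
  (forall t, (0 < t)%N -> doubly_stochastic (A t) /\ weighted_by zeta (E t) (A t)) ->
  (forall t, (0 < t)%N -> (0 < K t)%N) ->
  (* Assumption 3 *)
  bregman_lipschitz Nx X Rx KX -> bregman_lipschitz Ny Y Ry KY ->
  bregman_separately_convex n Rx -> bregman_separately_convex n Ry ->
  let V := path_variation Nx Ny B C xstar ystar in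
  (V : nat -> R^o) =o_\oo (fun T => T%:R : R^o) ->
  forall T : nat, (2 <= T)%N ->
  (* Assumption 4 *)
  (forall t, (1 <= t <= T)%N ->
    admissible_prediction Nx X Rx (B t) /\ admissible_prediction Ny Y Ry (C t)) ->
  (* Assumption 5 *)
  (forall t, (1 <= t <= T)%N -> strongly_connected (E t)) ->
  forall (disp : measure_display) (Omega : measurableType disp)
         (P : probability Omega R) (r : run R Omega n d m),
  multi_dosmd_cco P r X Y Rx Ry
    (polynomial_step eps1 gam1) (polynomial_step eps2 gam2) K E A B C x1 y1 T ->
  (* Assumption 2 *)
  stochastic_oracles P r Nx Ny LX LY X Y f T ->
  let Kmin := min_rounds K T in
  forall j : 'I_n,
  (ESP_regret P r f xstar ystar j T <=
    (c * Num.max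
       ((1 + Gamma1 n zeta * sigma1 n zeta ^+ Kmin.-1 /
             (1 - sigma1 n zeta ^+ Kmin)) * T%:R `^ theta1)
       (T%:R `^ theta2 * (1 + V T)))%:E)%E.
Proof.
move=> rhox0 rhoy0 eps10 eps20 gam101 gam201 theta1 theta2.
have [/andP[g10 g11] /andP[g20 g21]] := (gam101, gam201).
pose cx := regret_constant n gam1 gam2 eps1 eps2 rhox rhoy PsiX PsiY KX LX LY.
pose cy := regret_constant n gam2 gam1 eps2 eps1 rhoy rhox PsiY PsiX KY LY LX.
have cx0 : 0 <= cx by exact: regret_constant_ge0.
have cy0 : 0 <= cy by exact: regret_constant_ge0.
(* One constant per player, for the two signs of the regret; the 1 makes the sum strictly
   positive. *)
exists (cx + cy + 1); first by rewrite ltr_wpDl// addr_ge0.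
move=> Nx Ny X Y MX MY Rx Ry f xstar ystar zeta E A K B C hNx hNy fX fY xy1 dRx dRy
  PsiXE PsiYE ccf sad z01 AE K0 KXR KYR scx scy V _ T T2 BC scE disp Omega P r alg orac
  Kmin j.
have n0 : (0 < n)%N by exact: leq_trans (ltn_ord j).
have T1 : (1 <= T)%N by exact: leq_trans T2.
have range0 t : (1 <= t <= T)%N -> (0 < t)%N by case/andP.
have dsA t : (1 <= t <= T)%N -> doubly_stochastic (A t) by move=> /range0 /AE[].
have wA t : (1 <= t <= T)%N -> weighted_by zeta (E t) (A t) by move=> /range0 /AE[].
have KminK t : (1 <= t <= T)%N -> (Kmin <= K t)%N by exact: min_rounds_le.
have Kmin0 : (0 < Kmin)%N by exact: min_rounds_gt0.
have xX t : (1 <= t)%N -> X (xstar t) by move=> /sad[].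
have yY t : (1 <= t)%N -> Y (ystar t) by move=> /sad[].
have x1X i (w : Omega) : X (dec_x r i 1 w).
  by case: (run_init alg i w) => -> _; case: (xy1 i).
have y1Y i (w : Omega) : Y (dec_y r i 1 w).
  by case: (run_init alg i w) => _ ->; case: (xy1 i).
(* With the opposite gradient, the ascent of the second player becomes a mirror descent step. *)
pose gy i t w := - sgrad_y r i t w.
have xz i t w : (1 <= t <= T)%N -> grad Rx (dual_x r i t w) =
    grad Rx (dec_x r i t w) - polynomial_step eps1 gam1 t *: sgrad_x r i t w.
  by move=> /(run_mirror alg i w)[].
have yz i t w : (1 <= t <= T)%N -> grad Ry (dual_y r i t w) =
    grad Ry (dec_y r i t w) - polynomial_step eps2 gam2 t *: gy i t w.
  by rewrite /gy scalerN opprK => /(run_mirror alg i w)[].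
have xtz i t w : (1 <= t <= T)%N ->
    bregman_projection Rx X (dual_x r i t w) (proj_x r i t w).
  by move=> /(run_project alg i w)[].
have ytz i t w : (1 <= t <= T)%N ->
    bregman_projection Ry Y (dual_y r i t w) (proj_y r i t w).
  by move=> /(run_project alg i w)[].
have xS i t w : (1 <= t <= T)%N -> dec_x r i t.+1 w =
    consensus (E t) (A t) (K t) (fun j => B t *m proj_x r j t w) i.
  by move=> /(run_consensus alg i w)[].
have yS i t w : (1 <= t <= T)%N -> dec_y r i t.+1 w =
    consensus (E t) (A t) (K t) (fun j => C t *m proj_y r j t w) i.
  by move=> /(run_consensus alg i w)[].
have Bt t : (1 <= t <= T)%N -> admissible_prediction Nx X Rx (B t) by move=> /BC[].
have Ct t : (1 <= t <= T)%N -> admissible_prediction Ny Y Ry (C t) by move=> /BC[].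
have rangeS t : (1 <= t <= T)%N -> (1 <= t <= T.+1)%N by move=> /andP[-> /leqW].
have decX i t w : (1 <= t <= T)%N -> X (dec_x r i t w).
  move=> /rangeS; apply: (side_feasible fX dsA wA Bt x1X xtz xS).
have decY i t w : (1 <= t <= T)%N -> Y (dec_y r i t w).
  move=> /rangeS; apply: (side_feasible fY dsA wA Ct y1Y ytz yS).
pose mx i t w := grad (fun x => f i t x (dec_y r i t w)) (dec_x r i t w).
pose my i t w := grad (fun y => f i t (dec_x r i t w) y) (dec_y r i t w).
have ubx i t : (1 <= t <= T)%N ->
  unbiased_bounded P (history r t.-1) Nx LX (sgrad_x r i t) (mx i t) by move=> /(orac i)[_ []].
have uby i t : (1 <= t <= T)%N ->
  unbiased_bounded P (history r t.-1) Ny LY (sgrad_y r i t) (my i t) by move=> /(orac i)[_ []].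
have gxL (i : 'I_n) t (t1 : (1 <= t <= T)%N) := dual_norm_mean (history_setT r t.-1) (ubx i t t1).
have gyL i t : (1 <= t <= T)%N -> exists2 s, s <= LY ^+ 2 &
    has_mean P (fun w => dual_norm Ny (gy i t w) ^+ 2) s.
  move=> t1; have [s sL Es] := dual_norm_mean (history_setT r t.-1) (uby i t t1).
  by exists s => //; apply: eq_has_mean Es => w; rewrite /gy dual_normN.
have mesx i t l : (1 <= t <= T)%N -> measurable_fun setT (fun w => dec_x r i t w l 0).
  case: t => [//|[_|t /andP[_ /ltnW tT]]].
    (* [run_random] covers the decisions from index 2 on; the initial ones are constant. *)
    have -> : (fun w => dec_x r i 1 w l 0) = cst (x1 i l 0).
      by apply/funext => w; case: (run_init alg i w) => -> _.
    exact: measurable_cst.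
  by have [_ _ _ [mx' _]] := run_random alg i (tT : (1 <= t.+1 <= T)%N); exact: mx'.
have mesy i t l : (1 <= t <= T)%N -> measurable_fun setT (fun w => dec_y r i t w l 0).
  case: t => [//|[_|t /andP[_ /ltnW tT]]].
    have -> : (fun w => dec_y r i 1 w l 0) = cst (y1 i l 0).
      by apply/funext => w; case: (run_init alg i w) => _ ->.
    exact: measurable_cst.
  by have [_ _ _ [_ my']] := run_random alg i (tT : (1 <= t.+1 <= T)%N); exact: my'.
have [bX bXP] := feasible_coord_bound hNx fX.
have [bY bYP] := feasible_coord_bound hNy fY.
have martx : has_mean P (fun w => \sum_(1 <= t < T.+1) \sum_i
    dotv (mx i t w - sgrad_x r i t w) (dec_x r i t w - xstar t)) 0.
  apply: has_mean_sum0 => t; rewrite mem_index_iota ltnS => t1.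
  apply: has_mean_sum0 => i _.
  have := has_meanZ (-1) (unbiased_martingale (history_setT r t.-1) (ubx i t t1)
    (xstar t) (fun l => mesx i t l t1) (fun l U => history_dec_x r i t l U (range0 t t1))
    (fun w l => bXP _ l (decX i t w t1))).
  by rewrite mulr0; apply: eq_has_mean => w; rewrite mulN1r -dotvNl opprB.
have marty : has_mean P (fun w => \sum_(1 <= t < T.+1) \sum_i
    dotv (- my i t w - gy i t w) (dec_y r i t w - ystar t)) 0.
  apply: has_mean_sum0 => t; rewrite mem_index_iota ltnS => t1.
  apply: has_mean_sum0 => i _.
  have := (unbiased_martingale (history_setT r t.-1) (uby i t t1)
    (ystar t) (fun l => mesy i t l t1) (fun l U => history_dec_y r i t l U (range0 t t1))
    (fun w l => bYP _ l (decY i t w t1))).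
  by apply: eq_has_mean => w; rewrite /gy opprK addrC.
have a10 := @polynomial_step_gt0 R eps1 gam1 eps10.
have a20 := @polynomial_step_gt0 R eps2 gam2 eps20.
have a1n := @polynomial_step_noninc R eps1 gam1 eps10 gam101.
have a2n := @polynomial_step_noninc R eps2 gam2 eps20 gam201.
have [s1 s1U E1] := side_energy_mean (alpha := polynomial_step eps1 gam1) a10 gxL.
have [s2 s2U E2] := side_energy_mean (alpha := polynomial_step eps2 gam2) a20 gyL.
have l1_ge0 (L : R) : 0 <= 1 + L ^+ 2 by rewrite addr_ge0// sqr_ge0.
have lipx i t a b c : (1 <= t <= T)%N -> X a -> X b -> Y c ->
    f i t a c - f i t b c <= (1 + LX ^+ 2) * Nx (a - b).
  move=> t1 Xa Xb Yc; have [cf _ df _] := ccf i t (range0 t t1).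
  apply: (le_trans (convex_above_tangent b (cf c) (df _ _ Xa Yc))).
  (* The oracle condition at deterministic points gives the Lipschitz bounds; the one at the random
     decisions gave the martingale and energy terms. *)
  have [/(_ a c Xa Yc)[ux _] _] := orac i t t1.
  exact: (unbiased_dotv_le hNx (history_setT r t.-1) ux _
    (erefl : _ = cst (grad (fun x => f i t x c) a))).
have lipy i t a b c : (1 <= t <= T)%N -> Y a -> Y b -> X c ->
    f i t c b - f i t c a <= (1 + LY ^+ 2) * Ny (a - b).
  move=> t1 Ya Yb Xc; have [_ cf _ df] := ccf i t (range0 t t1).
  have dfa := df _ _ Xc Ya.
  have dNfa : differentiable ((fun v => - f i t c v) : _ -> R^o) a.
    exact: (@differentiableN _ _ _ ((fun v => f i t c v) : _ -> R^o)).
  have := convex_above_tangent b (cf c) dNfa.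
  rewrite gradN// dotvNl -dotvNr opprB => h.
  have [/(_ c a Xc Ya)[_ uy] _] := orac i t t1.
  have := unbiased_dotv_le hNy (history_setT r t.-1) uy (b - a)
    (erefl : _ = cst (grad (f i t c) a)).
  by rewrite (normv_distC hNy); lra.
have Lx i t a b c : (1 <= t <= T)%N -> X a -> X b -> Y c ->
    `|f i t a c - f i t b c| <= (1 + LX ^+ 2) * Nx (a - b).
  move=> t1 Xa Xb Yc; have h1 := lipx i t a b c t1 Xa Xb Yc.
  have := lipx i t b a c t1 Xb Xa Yc; rewrite (normv_distC hNx) => h2.
  by rewrite ler_norml; apply/andP; split; lra.
have Ly i t a b c : (1 <= t <= T)%N -> Y a -> Y b -> X c ->
    `|f i t c a - f i t c b| <= (1 + LY ^+ 2) * Ny (a - b).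
  move=> t1 Ya Yb Xc; have h1 := lipy i t a b c t1 Ya Yb Xc.
  have := lipy i t b a c t1 Yb Ya Xc; rewrite (normv_distC hNy) => h2.
  by rewrite ler_norml; apply/andP; split; lra.
have gapx t w : (1 <= t <= T)%N ->
    total_loss f t (dec_x r j t w) (dec_y r j t w) - total_loss f t (xstar t) (ystar t)
    <= \sum_i dotv (mx i t w) (dec_x r i t w - xstar t) +
       \sum_i ((1 + LX ^+ 2) * Nx (dec_x r i t w - dec_x r j t w) +
         2 * (1 + LY ^+ 2) * Ny (dec_y r i t w - dec_y r j t w)).
  move=> t1; apply: (loss_gap hNx hNy (X := X) (Y := Y) (f := fun i => f i t)
    (fun i a b c Xa Xb Yc => Lx i t a b c t1 Xa Xb Yc)
    (fun i a b c Ya Yb Xc => Ly i t a b c t1 Ya Yb Xc)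
    (x := fun i => dec_x r i t w) (y := fun i => dec_y r i t w)) => [i|i||i|].
  - exact: decX.
  - exact: decY.
  - exact: xX (range0 t t1).
  - have [cf _ df _] := ccf i t (range0 t t1).
    exact: (convex_above_tangent _ (cf _) (df _ _ (decX i t w t1) (decY i t w t1))).
  (* The upper side uses the saddle inequality for the second player, at the decision y of agent j;
     [gapy] uses the other one. *)
  - by have [_ _ + _] := sad t (range0 t t1); apply; exact: decY.
have gapy t w : (1 <= t <= T)%N ->
    total_loss f t (xstar t) (ystar t) - total_loss f t (dec_x r j t w) (dec_y r j t w)
    <= \sum_i dotv (- my i t w) (dec_y r i t w - ystar t) +
       \sum_i ((1 + LY ^+ 2) * Ny (dec_y r i t w - dec_y r j t w) +
         2 * (1 + LX ^+ 2) * Nx (dec_x r i t w - dec_x r j t w)).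
  move=> t1.
  have -> : total_loss f t (xstar t) (ystar t) -
      total_loss f t (dec_x r j t w) (dec_y r j t w) =
      \sum_i - f i t (dec_x r j t w) (dec_y r j t w) - - total_loss f t (xstar t) (ystar t).
    by rewrite sumrN opprK addrC.
  apply: (loss_gap hNy hNx (X := Y) (Y := X) (f := fun i y x => - f i t x y) _ _
    (x := fun i => dec_y r i t w) (y := fun i => dec_x r i t w)) => [i a b c|i a b c|i|i||i|].
  - by move=> Ya Yb Xc; rewrite -opprD normrN; exact: Ly.
  - by move=> Xa Xb Yc; rewrite -opprD normrN; exact: Lx.
  - exact: decY.
  - exact: decX.
  - exact: yY (range0 t t1).
  - have [_ cf _ df] := ccf i t (range0 t t1).
    have dfy := df _ _ (decX i t w t1) (decY i t w t1).
    rewrite /my -gradN//; apply: convex_above_tangent; first exact: cf.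
    exact: (@differentiableN _ _ _ ((fun v => f i t (dec_x r i t w) v) : _ -> R^o)).
  - rewrite sumrN lerN2.
    by have [_ _ _ +] := sad t (range0 t t1); apply; exact: decX.
have regx w := side_regret hNx fX rhox0 dRx KXR scx T1 dsA wA Bt a10 a1n x1X xX xz xtz xS w.
have regy w := side_regret hNy fY rhoy0 dRy KYR scy T1 dsA wA Ct a20 a2n y1Y yY yz ytz yS w.
have conx w i := side_consensus hNx n0 fX rhox0 dRx KXR z01 dsA wA scE KminK Kmin0 Bt
  a10 x1X xz xtz xS w i j.
have cony w i := side_consensus hNy n0 fY rhoy0 dRy KYR z01 dsA wA scE KminK Kmin0 Ct
  a20 y1Y yz ytz yS w i j.
set H := 1 + _ * _ / _; set U := T%:R `^ theta1; set W := T%:R `^ theta2.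
have TR1 : 1 <= T%:R :> R by rewrite ler1n.
have U_ge1 : 1 <= U.
  rewrite -(powRr0 (T%:R : R)) ler_powR//; rewrite le_max subr_ge0 ltW//.
have q01 : 0 < sigma1 n zeta ^+ Kmin < 1 by exact: sigma1_pow_bounds.
have qH := mixing_factor_le n0 Kmin0 z01.
have path0 (e : nat) (N : 'cV[R]_e -> R) (hN : is_norm N) D us : 0 <= path_length N D us T.
  by apply: sumr_ge0 => t _; exact: normv_ge0.
have VX : path_length Nx B xstar T <= V T by rewrite le_max lexx.
have VY : path_length Ny C ystar T <= V T by rewrite le_max lexx orbT.
have U1U : T%:R `^ (1 - gam1) <= U by rewrite ler_powR// le_max lexx.
have U2U : T%:R `^ (1 - gam2) <= U by rewrite ler_powR// le_max lexx orbT.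
have W1W : T%:R `^ gam1 <= W by rewrite ler_powR// le_max lexx.
have W2W : T%:R `^ gam2 <= W by rewrite ler_powR// le_max lexx orbT.
have {}s1U := le_trans s1U (ler_wpM2l (mulr_ge0 (ler0n R n) (l1_ge0 LX))
  (sum_polynomial_step eps10 gam101 T)).
have {}s2U := le_trans s2U (ler_wpM2l (mulr_ge0 (ler0n R n) (l1_ge0 LY))
  (sum_polynomial_step eps20 gam201 T)).
pose h w := \sum_(1 <= t < T.+1) total_loss f t (dec_x r j t w) (dec_y r j t w) -
  \sum_(1 <= t < T.+1) total_loss f t (xstar t) (ystar t).
rewrite PsiXE polynomial_stepV in regx; rewrite PsiYE polynomial_stepV in regy.
rewrite PsiXE in conx; rewrite PsiYE in cony.
have hx w := sum_gap_le (l1_ge0 LX) (l1_ge0 LY) (fun t => gapx t w) (regx w)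
  (conx w) (cony w).
have hy w := sum_gap_le (l1_ge0 LY) (l1_ge0 LX) (fun t => gapy t w) (regy w)
  (cony w) (conx w).
have [Gx [rx [hGx EGx rxU]]] := mean_regret_bound
  eps10 eps20 g11 g21 rhox0 rhoy0 q01 qH (path0 d Nx hNx B xstar) VX (powR_ge0 _ _)
  W1W U_ge1 U1U U2U martx E1 E2 s1U s2U hx.
have [Gy [ry [hGy EGy ryU]]] := mean_regret_bound
  eps20 eps10 g21 g11 rhoy0 rhox0 q01 qH (path0 m Ny hNy C ystar) VY (powR_ge0 _ _)
  W2W U_ge1 U2U U1U marty E2 E1 s2U s1U hy.
set bnd := Num.max _ _ in rxU ryU *.
have bnd0 : 0 <= bnd.
  rewrite le_max; apply/orP; right.
  by rewrite mulr_ge0 ?powR_ge0// addr_ge0// (le_trans _ VX)// path0.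
apply: (abse_expectation_le _ _ EGx EGy) => [w|w||].
- by apply: le_trans (hGx w); rewrite sumrB.
- by apply: le_trans (hGy w); rewrite opprB sumrB.
- by apply: (le_trans rxU); rewrite ler_wpM2r// -/cx; lra.
- by apply: (le_trans ryU); rewrite ler_wpM2r// -/cy; lra.
Qed.
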